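(* Let $(Q,g)$ be a semi-Riemannian manifold, let $T_0$ be a vector field on $Q$ and, for each $k\in\{1,2,\dots,s\}$, let $T_k$ be a symmetric $(k+1,0)$-tensor field on $Q$. Let $H:T^*Q\to\mathbb{R}$ be a mechanical Hamiltonian function with kinetic energy induced by $g$ and potential energy $V\in C^\infty(Q)$. Then the fiberwise sum $\Psi_T=\sum_{k=0}^{s}\Psi_{T_k}:T^*Q\to T^*Q$ is a fouling map for $H$ if and only if the following three conditions hold: (i) $R_{T_k}=i_{dV}T_{k+2}$ for $k=0,\dots,s-2$; (ii) $R_{T_k}=0$ for $k=s$ and $k=s-1$; (iii) $d(\flat(i_{dV}T_1))=0$.
   Context: $\omega_Q$ is the canonical symplectic form on $T^*Q$, locally $\omega_Q=dq^i\wedge dp_i$; $\pi_Q:T^*Q\to Q$ is the projection; $X_H$ is defined by $i_{X_H}\omega_Q=dH$. A bundle map over the identity is a smooth map $\Psi:T^*Q\to T^*Q$ with $\pi_Q\circ\Psi=\pi_Q$; it is a fouling map for $H$ if $\mathcal{L}_{X_H}(\Psi^*\omega_Q)=d(i_{X_H}\Psi^*\omega_Q)=0$. A mechanical Hamiltonian function on $(Q,g)$ with potential $V$ is $H(\alpha_q)=\frac12 g^*_q(\alpha_q,\alpha_q)+V(q)$, with $g^*$ the dual metric. $\flat:TQ\to T^*Q$, $\flat(X)=g(X,\cdot)$, and $\sharp=\flat^{-1}$. $(m,0)$-tensor fields are contravariant (multilinear on $m$ covectors); $i_\alpha T=T(\alpha,\cdot,\dots,\cdot)$ is contraction in the first slot.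 For a symmetric $(k+1,0)$-tensor field $T_k$ ($k\ge 0$; a vector field if $k=0$) the bundle map $\Psi_{T_k}:T^*Q\to T^*Q$ over the identity is $$\Psi_{T_k}(\alpha_q)(X_q)=\frac1{k!}\,T_k(\underbrace{\alpha_q,\dots,\alpha_q}_{k},\flat(X_q)),\qquad \alpha_q\in T_q^*Q,\ X_q\in T_qQ.$$ $R_{T_k}$ is the $(k+2,0)$-tensor field $$R_{T_k}(\alpha_0,\alpha_1,\dots,\alpha_{k+1})=\sum_{i=1}^{k+1}(\nabla_{\sharp\alpha_i}T_k)(\alpha_1,\dots,\alpha_{i-1},\alpha_0,\alpha_{i+1},\dots,\alpha_{k+1})-(\nabla_{\sharp\alpha_0}T_k)(\alpha_1,\dots,\alpha_{k+1}),$$ with $\nabla$ the Levi-Civita connection of $g$. In (iii), $i_{dV}T_1$ is a vector field and $\flat(i_{dV}T_1)$ the associated $1$-form. *)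

(* Defs.v *)
From HB Require Import structures.
From mathcomp Require Import all_boot all_order all_algebra all_fingroup.
From mathcomp Require Import all_classical all_reals all_analysis.

Set Implicit Arguments.
Unset Strict Implicit.
Unset Printing Implicit Defensive.
Import Order.TTheory GRing.Theory Num.Theory.
Import numFieldNormedType.Exports.
Local Open Scope classical_set_scope.
Local Open Scope ring_scope.

(* Encoding of tangent spaces.  Every point q of a manifold comes with a
   preferred chart chart_at q around it, and T_q M is identified with R^n (row
   vectors) by the differential of chart_at q.  All constructions below go
   through arbitrary charts by means of the differentials of the transition
   maps, so nothing depends on which preferred charts were selected.
   A covector at q is the row vector of its components in the dual basis. *)

Section Smooth.
Context {R : realType}.

Fixpoint Ck (k : nat) (V W : normedModType R) (U : set V) (f : V -> W) : Prop :=
  match k with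
  | 0%N => forall x, U x -> {for x, continuous f}
  | k'.+1 => (forall x, U x -> differentiable f x) /\
             (forall v, Ck k' U ('D_v f))
  end.

(* C^oo on an open set U; values of f outside U are irrelevant. *)
Definition smooth_on (V W : normedModType R) (U : set V) (f : V -> W) : Prop :=
  forall k, Ck k U f.

End Smooth.

Section Manifolds.
Context {R : realType}.

Record chart (n : nat) (M : Type) := Chart {
  cdom : set M ;
  cmap : M -> 'rV[R]_n ;
  cinv : 'rV[R]_n -> M }.

Definition cimg n M (c : chart n M) : set 'rV[R]_n := cmap c @` cdom c.

Record charted (n : nat) (M : Type) := Charted {
  atlas : set (chart n M) ;
  chart_at : M -> chart n M }.

Record smooth_manifold n (M : topologicalType) (A : charted n M) : Prop := {
  sm_hausdorff : hausdorff_space M ;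
  sm_countable : @second_countable M ;
  sm_chart_at : forall q, atlas A (chart_at A q) /\ cdom (chart_at A q) q ;
  sm_dom_open : forall c, atlas A c -> open (cdom c) ;
  sm_img_open : forall c, atlas A c -> open (cimg c) ;
  sm_cancel : forall c, atlas A c -> forall q, cdom c q -> cinv c (cmap c q) = q ;
  sm_map_cont : forall c, atlas A c ->
    forall q, cdom c q -> {for q, continuous (cmap c)} ;
  sm_inv_cont : forall c, atlas A c ->
    forall x, cimg c x -> {for x, continuous (cinv c)} ;
  sm_compat : forall c d, atlas A c -> atlas A d ->
    smooth_on (cmap c @` (cdom c `&` cdom d)) (cmap d \o cinv c) }.

(* This and what follows up to d1 does not use a topology on M, because it is
   also applied to the cotangent bundle with its natural charts. *)
Definition smooth_map m n M N (A : charted m M) (B : charted n N) (f : M -> N) :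
  Prop :=
  forall q, exists c d, [/\ atlas A c, atlas B d, cdom c q &
    exists U : set 'rV[R]_m, [/\ open U, U (cmap c q), U `<=` cimg c,
      (forall x, U x -> cdom d (f (cinv c x))) &
      smooth_on U (cmap d \o f \o cinv c)]].

Section Pointwise.
Context {n : nat} {M : Type} (A : charted n M).

Definition smooth_fun (f : M -> R) : Prop :=
  forall c, atlas A c -> smooth_on (cimg c) (f \o cinv c : 'rV[R]_n -> R^o).

(* components in the chart c of a tangent vector at q *)
Definition to_chart (c : chart n M) (q : M) : 'rV[R]_n -> 'rV[R]_n :=
  'd (cmap c \o cinv (chart_at A q)) (cmap (chart_at A q) q).

(* the tangent vector at q with given components in the chart c *)
Definition of_chart (c : chart n M) (q : M) : 'rV[R]_n -> 'rV[R]_n :=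
  'd (cmap (chart_at A q) \o cinv c) (cmap c q).

Definition pairing (a v : 'rV[R]_n) : R := (a *m v^T) 0 0.

Definition covector_of (l : 'rV[R]_n -> R) : 'rV[R]_n :=
  \row_j l (delta_mx 0 j).

Definition cov_to_chart (c : chart n M) (q : M) (a : 'rV[R]_n) : 'rV[R]_n :=
  covector_of (fun v => pairing a (of_chart c q v)).

Definition cov_of_chart (c : chart n M) (q : M) (p : 'rV[R]_n) : 'rV[R]_n :=
  covector_of (fun v => pairing p (to_chart c q v)).

Definition d0 (f : M -> R) (q : M) (v : 'rV[R]_n) : R :=
  'd (f \o cinv (chart_at A q) : 'rV[R]_n -> R^o) (cmap (chart_at A q) q) v.

Definition form_in_chart (c : chart n M) (b : M -> 'rV[R]_n -> R)
    (x v : 'rV[R]_n) : R :=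
  b (cinv c x) (of_chart c (cinv c x) v).

(* exterior derivative of a 1-form:
   (d b)_ij = d_i b_j - d_j b_i in the chart chart_at q *)
Definition d1 (b : M -> 'rV[R]_n -> R) (q : M) (v w : 'rV[R]_n) : R :=
  let c := chart_at A q in
  'D_v (form_in_chart c b ^~ w : 'rV[R]_n -> R^o) (cmap c q)
  - 'D_w (form_in_chart c b ^~ v : 'rV[R]_n -> R^o) (cmap c q).

Definition interior_product (X : M -> 'rV[R]_n) (w : M -> 'rV[R]_n -> 'rV[R]_n -> R) :
  M -> 'rV[R]_n -> R := fun q v => w q (X q) v.

End Pointwise.

Definition tangent_map m n M N (A : charted m M) (B : charted n N) (f : M -> N)
    (q : M) : 'rV[R]_m -> 'rV[R]_n :=
  'd (cmap (chart_at B (f q)) \o f \o cinv (chart_at A q))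
     (cmap (chart_at A q) q).

Definition pullback m n M N (A : charted m M) (B : charted n N) (f : M -> N)
    (w : N -> 'rV[R]_n -> 'rV[R]_n -> R) : M -> 'rV[R]_m -> 'rV[R]_m -> R :=
  fun q u v => w (f q) (tangent_map A B f q u) (tangent_map A B f q v).

End Manifolds.

Section CotangentBundle.
Context {R : realType} {n : nat}.

Record cotangent (Q : Type) := Covector { foot : Q ; comps : 'rV[R]_n }.

Context {Q : Type} (A : @charted R n Q).

(* natural coordinates (q^1, ..., q^n, p_1, ..., p_n) *)
Definition natural_chart (c : @chart R n Q) : @chart R (n + n) (cotangent Q) :=
  Chart [set m | cdom c (foot m)]
    (fun m => row_mx (cmap c (foot m)) (cov_to_chart A c (foot m) (comps m)))
    (fun z => let q := cinv c (lsubmx z) in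
              Covector q (cov_of_chart A c q (rsubmx z))).

Definition cotangent_charted : @charted R (n + n) (cotangent Q) :=
  Charted [set natural_chart c | c in atlas A]
          (fun m => natural_chart (chart_at A (foot m))).

(* dq^i /\ dp_i *)
Definition omega (m : cotangent Q) (u v : 'rV[R]_(n + n)) : R :=
  \sum_(i < n) (lsubmx u 0 i * rsubmx v 0 i - lsubmx v 0 i * rsubmx u 0 i).

Definition is_hamiltonian_vf (H : cotangent Q -> R)
    (X : cotangent Q -> 'rV[R]_(n + n)) : Prop :=
  forall m v, interior_product X omega m v = d0 cotangent_charted H m v.

Definition is_bundle_map (Psi : cotangent Q -> cotangent Q) : Prop :=
  smooth_map cotangent_charted cotangent_charted Psi /\
  (forall m, foot (Psi m) = foot m).

(* As omega is nondegenerate, X_H exists and is unique. *)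
Definition fouling_map (H : cotangent Q -> R) (Psi : cotangent Q -> cotangent Q) :
  Prop :=
  is_bundle_map Psi /\
  exists X, is_hamiltonian_vf H X /\
    forall m u v,
      d1 cotangent_charted
        (interior_product X (pullback cotangent_charted cotangent_charted Psi omega))
        m u v = 0.

End CotangentBundle.

Section SemiRiemannian.
Context {R : realType} {n : nat} {Q : Type} (A : @charted R n Q).

(* The metric is given at each q by its Gram matrix on T_q Q. *)
Definition gform (G : 'M[R]_n) (v w : 'rV[R]_n) : R := (v *m G *m w^T) 0 0.

Definition neg_def_on (G : 'M[R]_n) k (W : 'M[R]_(k, n)) : Prop :=
  row_free W /\
  (forall u : 'rV[R]_k, u != 0 -> gform G (u *m W) (u *m W) < 0).

Definition has_index (G : 'M[R]_n) (nu : nat) : Prop :=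
  (exists W : 'M[R]_(nu, n), neg_def_on G W) /\
  (forall k (W : 'M[R]_(k, n)), neg_def_on G W -> (k <= nu)%N).

Record semi_riemannian (g : Q -> 'M[R]_n) : Prop := {
  sr_sym : forall q, (g q)^T = g q ;
  sr_nondegenerate : forall q, g q \in unitmx ;
  sr_index : exists nu, forall q, has_index (g q) nu ;
  sr_smooth : forall c, atlas A c -> forall v w : 'rV[R]_n,
    smooth_on (cimg c) (fun x => let q := cinv c x in
      gform (g q) (of_chart A c q v) (of_chart A c q w) : R^o) }.

Context (g : Q -> 'M[R]_n).

Definition flat (q : Q) (v : 'rV[R]_n) : 'rV[R]_n := v *m g q.
Definition sharp (q : Q) (a : 'rV[R]_n) : 'rV[R]_n := a *m invmx (g q).
Definition dual_metric (q : Q) (a b : 'rV[R]_n) : R :=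
  gform (g q) (sharp q a) (sharp q b).

Definition mechanical (V : Q -> R) (m : @cotangent R n Q) : R :=
  2^-1 * dual_metric (foot m) (comps m) (comps m) + V (foot m).

Definition vf_in_chart (c : @chart R n Q) (Y : Q -> 'rV[R]_n) (x : 'rV[R]_n) :
  'rV[R]_n := to_chart A c (cinv c x) (Y (cinv c x)).

Definition coord_vf (c : @chart R n Q) (j : 'I_n) (q : Q) : 'rV[R]_n :=
  of_chart A c q (delta_mx 0 j).

Definition smooth_near (W : normedModType R) (q : Q)
    (F : @chart R n Q -> 'rV[R]_n -> W) : Prop :=
  let c := chart_at A q in
  exists U : set 'rV[R]_n,
    [/\ open U, U (cmap c q), U `<=` cimg c & smooth_on U (F c)].

Definition fun_smooth_near (q : Q) (f : Q -> R) : Prop :=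
  smooth_near q (fun c => f \o cinv c : 'rV[R]_n -> R^o).

Definition vf_smooth_near (q : Q) (Y : Q -> 'rV[R]_n) : Prop :=
  smooth_near q (fun c => vf_in_chart c Y).

Definition lie_bracket (X Y : Q -> 'rV[R]_n) (q : Q) : 'rV[R]_n :=
  let c := chart_at A q in
  'D_(X q) (vf_in_chart c Y) (cmap c q) - 'D_(Y q) (vf_in_chart c X) (cmap c q).

(* nabla q v Y is the covariant derivative at q, in the direction v, of a vector
   field Y which is only required to be smooth near q: this lets coordinate
   vector fields be differentiated directly.  Dependence on the germ of Y alone
   follows from the Leibniz rule (take f the indicator of a neighbourhood). *)
Record is_connection (nabla : Q -> 'rV[R]_n -> (Q -> 'rV[R]_n) -> 'rV[R]_n) :
  Prop := {
  nabla_lin : forall q Y (a : R) v w, vf_smooth_near q Y ->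
    nabla q (a *: v + w) Y = a *: nabla q v Y + nabla q w Y ;
  nabla_add : forall q v Y Z, vf_smooth_near q Y -> vf_smooth_near q Z ->
    nabla q v (fun x => Y x + Z x) = nabla q v Y + nabla q v Z ;
  nabla_leibniz : forall q v f Y, fun_smooth_near q f -> vf_smooth_near q Y ->
    nabla q v (fun x => f x *: Y x) = f q *: nabla q v Y + d0 A f q v *: Y q ;
  nabla_smooth : forall q X Y, vf_smooth_near q X -> vf_smooth_near q Y ->
    vf_smooth_near q (fun x => nabla x (X x) Y) }.

Record levi_civita (nabla : Q -> 'rV[R]_n -> (Q -> 'rV[R]_n) -> 'rV[R]_n) :
  Prop := {
  lc_connection : is_connection nabla ;
  lc_torsion_free : forall q X Y, vf_smooth_near q X -> vf_smooth_near q Y ->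
    nabla q (X q) Y - nabla q (Y q) X = lie_bracket X Y q ;
  lc_metric : forall q v Y Z, vf_smooth_near q Y -> vf_smooth_near q Z ->
    d0 A (fun x => gform (g x) (Y x) (Z x)) q v =
    gform (g q) (nabla q v Y) (Z q) + gform (g q) (Y q) (nabla q v Z) }.

(* An (m,0)-tensor field maps q to a function of m covectors at q. *)
Notation tensor m := (Q -> ('I_m -> 'rV[R]_n) -> R).

Definition multilinear m (t : ('I_m -> 'rV[R]_n) -> R) : Prop :=
  forall (al : 'I_m -> 'rV[R]_n) (i : 'I_m) (a : R) (b b' : 'rV[R]_n),
    t [eta al with i |-> a *: b + b'] =
    a * t [eta al with i |-> b] + t [eta al with i |-> b'].

Definition tensor_in_chart m (c : @chart R n Q) (T : tensor m)
    (p : 'I_m -> 'rV[R]_n) (x : 'rV[R]_n) : R :=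
  let q := cinv c x in T q (fun i => cov_of_chart A c q (p i)).

Record tensor_field m (T : tensor m) : Prop := {
  tf_multilinear : forall q, multilinear (T q) ;
  tf_smooth : forall c, atlas A c -> forall p,
    smooth_on (cimg c) (tensor_in_chart c T p : 'rV[R]_n -> R^o) }.

Definition tensor_symmetric m (T : tensor m) : Prop :=
  forall q (al : 'I_m -> 'rV[R]_n) (s : {perm 'I_m}), T q (al \o s) = T q al.

Definition cov_cons m (b : 'rV[R]_n) (al : 'I_m -> 'rV[R]_n) :
  'I_m.+1 -> 'rV[R]_n := fun i => if unlift ord0 i is Some j then al j else b.

Definition contract_first m (b : Q -> 'rV[R]_n) (T : tensor m.+1) : tensor m :=
  fun q al => T q (cov_cons (b q) al).

Definition vf_of_tensor (T : tensor 1) (q : Q) : 'rV[R]_n :=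
  \row_j T q (fun=> delta_mx 0 j).

(* the differential of f as a covector field *)
Definition d_cov (f : Q -> R) (q : Q) : 'rV[R]_n := covector_of (d0 A f q).

Context (nabla : Q -> 'rV[R]_n -> (Q -> 'rV[R]_n) -> 'rV[R]_n).

(* nabla_v at q of the 1-form with constant components a in chart_at q, from
   (nabla_v a)(Y) = v (a (Y)) - a (nabla_v Y) with Y a coordinate field, for
   which a (Y) is constant *)
Definition nabla_cov (q : Q) (v a : 'rV[R]_n) : 'rV[R]_n :=
  \row_j (- pairing a (nabla q v (coord_vf (chart_at A q) j))).

(* (nabla_v T)(al_0,...) =
     v (T (al_0,...)) - sum_r T (al_0, ..., nabla_v al_r, ...),
   each al_r being extended with constant components in chart_at q *)
Definition nabla_tensor m (T : tensor m) (q : Q) (v : 'rV[R]_n)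
    (al : 'I_m -> 'rV[R]_n) : R :=
  let c := chart_at A q in
  'D_v (tensor_in_chart c T al : 'rV[R]_n -> R^o) (cmap c q)
  - \sum_(r < m) T q [eta al with r |-> nabla_cov q v (al r)].

Definition RT k (T : tensor k.+1) : tensor k.+2 := fun q al =>
  let al0 := al ord0 in
  let tl := fun i : 'I_k.+1 => al (lift ord0 i) in
  \sum_(i < k.+1) nabla_tensor T q (sharp q (tl i)) [eta tl with i |-> al0]
  - nabla_tensor T q (sharp q al0) tl.

Definition Psi_comps k (T : tensor k.+1) (q : Q) (a : 'rV[R]_n) : 'rV[R]_n :=
  covector_of (fun X =>
    (k`!%:R)^-1 * T q (fun i => if i == ord_max then flat q X else a)).

Definition Psi_sum (s : nat) (T : forall k : nat, tensor k.+1)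
    (m : @cotangent R n Q) : @cotangent R n Q :=
  Covector (foot m) (\sum_(k < s.+1) Psi_comps (T k) (foot m) (comps m)).

End SemiRiemannian.

Notation tensor R n Q m := (Q -> ('I_m -> 'rV[R]_n) -> R).

(* Main.v *)
(* Put theta = i_X (Psi^* omega).  At a covector (q, p), in the preferred chart
   at q, the Christoffel symbols turn the partial derivatives into covariant ones
   and theta becomes dF - rho, where F is a smooth function on T^*Q and rho is
   horizontal, with
     rho(v) = sum_k [R_{T_k}(flat v, p, .., p) / (k+1)!
                     - T_k(dV, flat v, p, .., p) / (k-1)!].
   Since rho is given pointwise by tensors, this identity persists in every chart
   by the chain rule, without any use of the invariance of omega.  The exact part
   is killed by d (symmetry of second derivatives), so theta is closed iff rho is.
   As rho is horizontal, closedness forces rho to be independent of p: its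
   homogeneous parts of degree k+1 in p vanish, which after polarization is
   (i) and (ii).  What is left of rho is the pullback of - flat (i_{dV} T_1), which
   is closed iff (iii) holds. *)

(* On a vertical vector, theta is the fibre derivative of Psi_T paired with sharp p, that is, the
   sum of the k/k! T_k(p, .., p, .). This is the fibre derivative of F = sum_k k/(k+1)! T_k(p, ..,
   p), which is why subtracting dF leaves a horizontal form. Horizontality then does the work: for u
   vertical and w horizontal, d rho(u, w) is just the derivative of rho(w) along u, since rho(u)
   vanishes. No constant survives in (i) because the dV term of T_{k+2} has the same degree k+1 in p
   and the same coefficient 1/(k+1)! as the R_{T_k} term; R_{T_{s-1}} and R_{T_s} have no partner.
   The obstacle is the encoding of tangent spaces: vectors at different points are components in
   different preferred charts, which need not vary continuously with the point. Pointwise identities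
   are therefore proved at the centre of a preferred chart, where all chart conversions are the
   identity, whereas smoothness and derivatives are always taken in one fixed chart. *)
Require Import Defs.
From HB Require Import structures.
From mathcomp Require Import all_boot all_order all_algebra all_fingroup.
From mathcomp Require Import all_classical all_reals all_analysis.
From mathcomp Require Import ring.
Import Order.TTheory GRing.Theory Num.Theory.
Import numFieldNormedType.Exports.
Local Open Scope classical_set_scope.
Local Open Scope ring_scope.
Set Implicit Arguments.
Unset Strict Implicit.
Unset Printing Implicit Defensive.

(** * Derivatives in normed modules *)

Section NearDifferentiable.
Context {R : realType} {V W : normedModType R}.
Implicit Types (f g : V -> W) (x v : V).

(** Differentiability depends only on the germ: this expansion of [g] with the differential of [f]
    yields both lemmas below by uniqueness of the differential. *)
Lemma near_eq_diff_expansion f g x :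
  (\near x, f x = g x) -> differentiable f x ->
  g \o shift x = cst (g x) + 'd f x +o_ 0 id.
Proof.
move=> fg df; apply/eqaddoP => e e0.
have /eqaddoP /(_ e e0) := diff_locally df.
move=> H; near=> h.
have -> : (g \o shift x - (cst (g x) + 'd f x)) h =
          (f \o shift x - (cst (f x) + 'd f x)) h.
  rewrite -[LHS]/(g (h + x) - (g x + 'd f x h)).
  rewrite -[RHS]/(f (h + x) - (f x + 'd f x h)).
  by rewrite (nbhs_singleton fg); congr (_ - _); symmetry; near: h;
    move: fg; rewrite (near_shift 0 x); apply: filterS => y /=; rewrite subr0.
near: h; exact: H.
Unshelve. all: by end_near. Qed.

Lemma near_eq_diff f g x :
  (\near x, f x = g x) -> differentiable f x ->
  'd g x = 'd f x :> (V -> W).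
Proof.
move=> fg df; apply: diff_unique; first exact: diff_continuous.
exact: near_eq_diff_expansion.
Qed.

Lemma near_eq_differentiable f g x :
  (\near x, f x = g x) -> differentiable f x -> differentiable g x.
Proof.
move=> fg df; apply/diff_locallyP; rewrite (near_eq_diff fg df).
split; first exact: diff_continuous.
exact: near_eq_diff_expansion.
Qed.

Lemma differentiable_is_derive f x v :
  differentiable f x -> is_derive x v f ('d f x v).
Proof.
by move=> df; apply: DeriveDef; [exact: diff_derivable|exact: deriveE].
Qed.

Lemma diff_is_derive f x v df :
  differentiable f x -> is_derive x v f df -> 'd f x v = df.
Proof. by move=> dfx [_ <-]; rewrite deriveE. Qed.

End NearDifferentiable.

Section LinearMaps.
Context {R : realType}.

(** The source is finite-dimensional: [L] is a finite combination of coordinate functions with fixed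
    vectors as coefficients. *)
Lemma linear_rV_continuous (n : nat) (W : normedModType R)
    (L : {linear 'rV[R]_n -> W}) : continuous L.
Proof.
have -> : (L : 'rV[R]_n -> W) = (fun v => \sum_(j < n) v 0 j *: L (delta_mx 0 j)).
  apply/funext => v; rewrite [in LHS](row_sum_delta v) linear_sum.
  by apply: eq_bigr => j _; rewrite linearZ.
have -> : (fun v : 'rV[R]_n => \sum_(j < n) v 0 j *: L (delta_mx 0 j)) =
    \sum_(j < n) (fun v : 'rV[R]_n => v 0 j *: L (delta_mx 0 j)).
  by apply/funext => v; rewrite fct_sumE.
move=> v; apply/differentiable_continuous/differentiable_sum => j.
by apply: differentiableZl; apply: differentiable_coord.
Qed.

Lemma linear_rV_differentiable (n : nat) (W : normedModType R)
    (L : {linear 'rV[R]_n -> W}) v : differentiable L v.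
Proof. by apply: linear_differentiable; apply: linear_rV_continuous. Qed.

(** The two difference quotients agree for every [h], so derivatives along vectors pass through a
    linear inner map by mere rewriting. *)
Fact growth_rate_comp_linear (V' V W : normedModType R) (L : {linear V' -> V})
    (f : V -> W) z w :
  (fun h : R => h^-1 *: (((f \o L) \o shift z) (h *: w) - (f \o L) z)) =
  (fun h : R => h^-1 *: ((f \o shift (L z)) (h *: L w) - f (L z))).
Proof. by apply/funext => h /=; rewrite (linearD L) (linearZZ L). Qed.

Lemma derive_comp_linear (V' V W : normedModType R) (L : {linear V' -> V})
    (f : V -> W) z w : 'D_w (f \o L) z = 'D_(L w) f (L z).
Proof. by rewrite /derive growth_rate_comp_linear. Qed.

Lemma is_derive_comp_linear (V' V W : normedModType R) (L : {linear V' -> V})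
    (f : V -> W) z w df : is_derive (L z) (L w) f df -> is_derive z w (f \o L) df.
Proof.
move=> [cf <-]; apply: DeriveDef; last exact: derive_comp_linear.
by rewrite /derivable growth_rate_comp_linear.
Qed.

Lemma differentiable_rV (V : normedModType R) n (f : V -> 'rV[R]_n) x :
  (forall j, differentiable (fun y => f y 0 j : R^o) x) -> differentiable f x.
Proof.
move=> df.
have -> : f = \sum_(j < n) (fun y => f y 0 j *: delta_mx 0 j).
  by apply/funext => y; rewrite fct_sumE; exact: row_sum_delta.
by apply: differentiable_sum => j; apply: differentiableZl; exact: df.
Qed.

Lemma is_derive_linear (m : nat) (W : normedModType R)
    (L : {linear 'rV[R]_m -> W}) z w : is_derive z w L (L w).
Proof.
have d := linear_rV_differentiable L z.
apply: (is_derive_eq (differentiable_is_derive w d)).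
by rewrite diff_lin //; apply: linear_rV_continuous.
Qed.

Lemma is_derive_coord (V : normedModType R) m n (f : V -> 'M[R]_(m, n)) x v df i j :
  is_derive x v f df -> is_derive x v (fun y => f y i j : R^o) (df i j).
Proof.
move=> [cf <-]; apply: DeriveDef; first exact: ((derivable_mxP _ _ _).1 cf).
by rewrite derive_mx // mxE.
Qed.

Lemma is_derive_affine (n : nat) (p b : 'rV[R]_n) (r : R^o) :
  is_derive r (1 : R^o) (fun r : R^o => p + r *: b) b.
Proof.
have dscale : is_diff r ( *:%R ^~ b : R^o -> 'rV[R]_n) ( *:%R ^~ b).
  exact: is_diff_scalel.
have dl := @differentiable_is_derive _ _ _ _ r 1 (@ex_diff _ _ _ _ _ _ _ dscale).
rewrite diff_val /= scale1r in dl.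
by apply: (is_derive_eq (is_deriveD (is_derive_cst p _ _) dl)); rewrite add0r.
Qed.

Lemma is_derive_mx (V : normedModType R) m n (f : V -> 'M[R]_(m, n)) x v
    (df : 'M[R]_(m, n)) :
  (forall i j, is_derive x v (fun y => f y i j : R^o) (df i j)) ->
  is_derive x v f df.
Proof.
move=> h; have cf : derivable f x v.
  by apply/derivable_mxP => i j; have [] := h i j.
apply: DeriveDef => //; rewrite derive_mx //; apply/matrixP => i j.
by rewrite mxE; have [_] := h i j.
Qed.

End LinearMaps.

Section Products.
Context {R : realType} {V : normedModType R}.

Lemma is_derive_mul (f g : V -> R^o) x v df dg :
  is_derive x v f df -> is_derive x v g dg ->
  is_derive x v (fun z => f z * g z : R^o) (f x * dg + g x * df).
Proof. exact: is_deriveM. Qed.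

Lemma is_derive_mull (a : R) (f : V -> R^o) x v df :
  is_derive x v f df -> is_derive x v (fun y => a * f y : R^o) (a * df).
Proof. exact: is_deriveZ. Qed.

Lemma is_derive_bigsum (I : Type) (r : seq I) (f : I -> V -> R^o) df x v :
  (forall i, is_derive x v (f i) (df i)) ->
  is_derive x v (fun y => \sum_(i <- r) f i y : R^o) (\sum_(i <- r) df i).
Proof.
move=> h; elim: r => [|a r ih].
  rewrite big_nil (_ : (fun _ => _) = cst 0); first exact: is_derive_cst.
  by apply/funext => y; rewrite big_nil.
rewrite big_cons.
have -> : (fun y => \sum_(i <- a :: r) f i y : R^o) =
   (f a \+ (fun y => \sum_(i <- r) f i y : R^o)).
  by apply/funext => y; rewrite big_cons.
exact: is_deriveD.
Qed.

End Products.

(** * Closure properties of C^k maps *)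

Section CkTheory.
Context {R : realType}.

Lemma Ck_ext (V W : normedModType R) (U : set V) k (f g : V -> W) :
  open U -> (forall x, U x -> f x = g x) -> Ck k U f -> Ck k U g.
Proof.
move=> oU; elim: k f g => [|k ih] f g fg /=.
  move=> cf x Ux; have nU : nbhs x U by apply: open_nbhs_nbhs.
  have fgx : \near x, f x = g x by apply: filterS nU.
  move: (cf x Ux); rewrite /prop_for /continuous_at (fg _ Ux) => cfx.
  by apply: cvg_trans cfx; apply: near_eq_cvg.
have near_fg x : U x -> \near x, f x = g x.
  move=> Ux; have nU : nbhs x U by apply: open_nbhs_nbhs.
  by apply: filterS nU.
move=> [df Df]; split=> [x Ux|v].
  exact: near_eq_differentiable (near_fg _ Ux) (df x Ux).
apply: ih (Df v) => x Ux; apply: near_eq_derive; exact: near_fg.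
Qed.

Lemma CkS (V W : normedModType R) (U : set V) k (f : V -> W) :
  Ck k.+1 U f -> Ck k U f.
Proof.
elim: k f => [|k ih] f [df Df].
  by move=> x Ux; apply: differentiable_continuous; apply: df.
by split=> // v; apply: ih; apply: Df.
Qed.

Lemma derive_cst_fun (V W : normedModType R) (a : W) v :
  'D_v (cst a : V -> W) = cst 0.
Proof. by apply/funext => x; rewrite derive_cst. Qed.

Lemma Ck_cst (V W : normedModType R) (U : set V) k (a : W) :
  Ck k U (cst a : V -> W).
Proof.
elim: k a => [|k ih] a; first by move=> x _; apply: cst_continuous.
split=> [x _|v]; first exact: differentiable_cst.
by rewrite derive_cst_fun; apply: ih.
Qed.

Lemma CkD (V W : normedModType R) (U : set V) k (f g : V -> W) :
  open U -> Ck k U f -> Ck k U g -> Ck k U (f \+ g).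
Proof.
move=> oU; elim: k f g => [|k ih] f g.
  by move=> cf cg x Ux; apply: cvgD; [apply: cf|apply: cg].
move=> [df Df] [dg Dg]; split=> [x Ux|v].
  exact: (differentiableD (df x Ux) (dg x Ux)).
apply: Ck_ext (ih _ _ (Df v) (Dg v)) => // x Ux.
by rewrite deriveD //; apply: diff_derivable; [apply: df|apply: dg].
Qed.

Lemma CkM (V : normedModType R) (U : set V) k (f g : V -> R^o) :
  open U -> Ck k U f -> Ck k U g -> Ck k U (f \* g : V -> R^o).
Proof.
move=> oU; elim: k f g => [|k ih] f g.
  by move=> cf cg x Ux; exact: (cvgM (cf x Ux) (cg x Ux)).
move=> Cf Cg; have [df Df] := Cf; have [dg Dg] := Cg; split=> [x Ux|v].
  exact: (differentiableM (df x Ux) (dg x Ux)).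
apply: (@Ck_ext _ _ _ _ ((f \* 'D_v g : V -> R^o) \+ (g \* 'D_v f : V -> R^o))) => //.
  by move=> x Ux; rewrite deriveM //; apply: diff_derivable; [apply: df|apply: dg].
by apply: (CkD oU (ih _ _ (CkS Cf) (Dg v)) (ih _ _ (CkS Cg) (Df v))).
Qed.

Lemma Ck_sum (V W : normedModType R) (U : set V) k (I : Type) (r : seq I)
    (f : I -> V -> W) : open U -> (forall i, Ck k U (f i)) ->
  Ck k U (fun x => \sum_(i <- r) f i x).
Proof.
move=> oU h; elim: r => [|a r ih].
  rewrite (_ : (fun _ => _) = cst 0); first exact: Ck_cst.
  by apply/funext => y; rewrite big_nil.
rewrite (_ : (fun _ => _) = f a \+ (fun x => \sum_(i <- r) f i x)).
  exact: CkD.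
by apply/funext => y; rewrite big_cons.
Qed.

Lemma Ck_prod (V : normedModType R) (U : set V) k (I : Type) (r : seq I)
    (f : I -> V -> R^o) : open U -> (forall i, Ck k U (f i)) ->
  Ck k U (fun x => \prod_(i <- r) f i x : R^o).
Proof.
move=> oU h; elim: r => [|a r ih].
  rewrite (_ : (fun _ => _) = cst 1); first exact: Ck_cst.
  by apply/funext => y; rewrite big_nil.
rewrite (_ : (fun _ => _) = (f a \* (fun x => \prod_(i <- r) f i x : R^o) : V -> R^o)).
  exact: CkM.
by apply/funext => y; rewrite big_cons.
Qed.

(** The induction closes because a directional derivative of [f \o L] is a directional derivative of
    [f] composed with the same [L]. Linear inner maps suffice for higher regularity, which is always
    established within a single chart. *)
Lemma Ck_comp_linear (V' V W : normedModType R) (L : {linear V' -> V})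
    (U : set V) (U' : set V') k (f : V -> W) :
  continuous L -> (forall x, U' x -> U (L x)) -> Ck k U f -> Ck k U' (f \o L).
Proof.
move=> cL LU; elim: k f => [|k ih] f.
  move=> cf x Ux; apply: continuous_comp; first exact: cL.
  by apply: cf; apply: LU.
move=> [df Df]; split=> [x Ux|v].
  apply: differentiable_comp; last by apply: df; apply: LU.
  exact: linear_differentiable.
rewrite (_ : 'D_v (f \o L) = ('D_(L v) f) \o L); first exact: (ih _ (Df _)).
by apply/funext => x; rewrite derive_comp_linear.
Qed.

Lemma Ck_linear (n : nat) (W : normedModType R) (L : {linear 'rV[R]_n -> W})
    (U : set 'rV[R]_n) k : Ck k U L.
Proof.
case: k => [|k].
  by move=> x _; apply: linear_rV_continuous.
split=> [x _|v]; first exact: linear_rV_differentiable.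
rewrite (_ : 'D_v (L : _ -> _) = cst (L v)); first exact: Ck_cst.
apply/funext => x; rewrite deriveE; last exact: linear_rV_differentiable.
by rewrite diff_lin //; apply: linear_rV_continuous.
Qed.

Lemma Ck_coord (V : normedModType R) m n (U : set V) k (f : V -> 'M[R]_(m, n)) i j :
  open U -> Ck k U f -> Ck k U (fun x => f x i j : R^o).
Proof.
move=> oU; elim: k f => [|k ih] f.
  move=> cf x Ux; apply: (@continuous_comp _ _ _ f (fun M : 'M[R]_(m, n) => M i j)).
    exact: cf.
  exact: coord_continuous.
move=> [df Df]; split=> [x Ux|v].
  apply: (@differentiable_comp _ _ _ _ f (fun M : 'M[R]_(m, n) => M i j)).
    exact: df.
  exact: differentiable_coord.
apply: Ck_ext (ih _ (Df v)) => // x Ux.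
by rewrite derive_mx ?mxE //; apply: diff_derivable; apply: df.
Qed.

Lemma Ck_scalel (V W : normedModType R) (U : set V) k (f : V -> R^o) (a : W) :
  open U -> Ck k U f -> Ck k U (fun x => f x *: a).
Proof.
move=> oU; elim: k f => [|k ih] f.
  by move=> cf x Ux; apply: cvgZr_tmp; apply: cf.
move=> [df Df]; split=> [x Ux|v]; first by apply: differentiableZl; apply: df.
apply: Ck_ext (ih _ (Df v)) => // x Ux.
have dfx := df x Ux.
rewrite [RHS]deriveE; last exact: differentiableZl.
by rewrite diffZl //= deriveE.
Qed.

Lemma Ck_rV (V : normedModType R) n (U : set V) k (f : V -> 'rV[R]_n) :
  open U -> (forall j, Ck k U (fun x => f x 0 j : R^o)) -> Ck k U f.
Proof.
move=> oU h.
rewrite (_ : f = fun x => \sum_(j < n) f x 0 j *: delta_mx 0 j).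
  by apply: Ck_sum => // j; apply: Ck_scalel.
by apply/funext => x; apply: row_sum_delta.
Qed.

End CkTheory.

(** * Symmetry of second derivatives *)

Section Schwarz.
Context {R : realType} {V : normedModType R}.
Implicit Types (f : V -> R^o) (U : set V).

Lemma is_derive_line f a u (t : R) : differentiable f (a + t *: u) ->
  is_derive t 1 (fun r : R => f (a + r *: u) : R^o) ('D_u f (a + t *: u)).
Proof.
move=> df; have E : (fun h : R => h^-1 *: (((fun r : R => f (a + r *: u)) \o shift t)
      (h *: 1) - f (a + t *: u))) =
   (fun h : R => h^-1 *: ((f \o shift (a + t *: u)) (h *: u) - f (a + t *: u))).
  apply/funext => h /=; congr (_ *: (f _ - _)).
  by rewrite -[h *: 1]/(h * 1) mulr1 scalerDl addrCA.
apply: DeriveDef; last by rewrite /derive E.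
by rewrite /derivable E; apply: diff_derivable.
Qed.

Lemma MVT_line f a u (s : R) : 0 < s ->
  (forall r : R, 0 <= r <= s -> differentiable f (a + r *: u)) ->
  exists2 r, 0 <= r <= s & f (a + s *: u) - f a = s * 'D_u f (a + r *: u).
Proof.
move=> s0 df.
have dline r : 0 <= r <= s ->
    is_derive r 1 (fun r : R => f (a + r *: u) : R^o) ('D_u f (a + r *: u)).
  by move=> rs; apply: is_derive_line => //; apply: df.
have [||c] := @MVT R (fun r : R => f (a + r *: u))
  (fun r => 'D_u f (a + r *: u)) 0 s s0.
- by move=> x; rewrite in_itv /= => /andP[x0 xs]; apply: dline; rewrite !ltW.
- apply: derivable_within_continuous => x; rewrite in_itv /= => xs.
  by have [] := dline x xs.
rewrite in_itv /= => /andP[c0 cs]; rewrite scale0r addr0 subr0 => E.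
by exists c; [rewrite !ltW|rewrite E mulrC].
Qed.

Lemma derive_comp_shift f x c u : 'D_u (f \o shift c) x = 'D_u f (x + c).
Proof.
rewrite /derive.
have -> // : (fun h : R => h^-1 *: (((f \o shift c) \o shift x) (h *: u) - (f \o shift c) x))
  = (fun h : R => h^-1 *: ((f \o shift (x + c)) (h *: u) - f (x + c))).
by apply/funext => h /=; rewrite addrA.
Qed.

(** The mean value theorem is applied twice: along [u] to the increment of [f] in the direction [v],
    then along [v] to ['D_u f]. The left-hand side is symmetric in [u] and [v], which is what the
    next lemma exploits. *)
Lemma second_difference f U a u v (s : R) : 0 < s ->
  (forall p q : R, 0 <= p <= s -> 0 <= q <= s -> U (a + p *: u + q *: v)) ->
  Ck 2 U f ->
  exists p q : R, [/\ 0 <= p <= s, 0 <= q <= s &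
    f (a + s *: u + s *: v) - f (a + s *: u) - f (a + s *: v) + f a =
    s * (s * 'D_v ('D_u f) (a + p *: u + q *: v))].
Proof.
move=> s0 sU [df Df].
have ss : 0 <= s <= s by rewrite lexx ltW.
have s00 : 0 <= (0 : R) <= s by rewrite lexx ltW.
have sU0 p : 0 <= p <= s -> U (a + p *: u).
  by move=> ps; have := sU p 0 ps s00; rewrite scale0r addr0.
pose h : V -> R^o := fun x => f (x + s *: v) - f x.
have dshift x : U (x + s *: v) -> differentiable (f \o shift (s *: v)) x.
  move=> Ux; apply: differentiable_comp; last exact: df.
  exact: differentiableD.
have dh p : 0 <= p <= s -> differentiable h (a + p *: u).
  move=> ps; apply: differentiableB; last by apply: df; apply: sU0.
  by apply: dshift; apply: sU.
have [p ps E1] := MVT_line s0 dh.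
have Dh : 'D_u h (a + p *: u) =
    'D_u f (a + p *: u + s *: v) - 'D_u f (a + p *: u).
  rewrite deriveB; first last.
  - by apply: diff_derivable; apply: df; apply: sU0.
  - by apply: diff_derivable; apply: dshift; apply: sU.
  by congr (_ - _); apply: derive_comp_shift.
have dDu q : 0 <= q <= s -> differentiable ('D_u f) (a + p *: u + q *: v).
  by move=> qs; have [+ _] := Df u; apply; apply: sU.
have [q qs E2] := MVT_line s0 dDu.
exists p, q; split=> //; rewrite -E2 -Dh -E1 /h.
by rewrite opprB addrA addrAC -!addrA; congr (_ + _); rewrite addrCA [RHS]addrC !addrA.
Qed.

(** The same second difference, read in the two orders, equates the two mixed derivatives at two
    nearby points; continuity at [a] brings both points to [a]. *)
Lemma Ck2_sym f U a u v : open U -> U a -> Ck 2 U f ->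
  'D_v ('D_u f) a = 'D_u ('D_v f) a.
Proof.
move=> oU Ua Cf; have [df Df] := Cf.
have cDD w w' : {for a, continuous ('D_w ('D_w' f))}.
  by have [_ /(_ w)] := Df w'; apply.
apply/eqP; rewrite -subr_eq0 -normr_le0; apply/ler_addgt0Pl => e e0.
rewrite addr0.
have e2 : 0 < e / 2 by rewrite divr_gt0.
have [d d0 dP] : exists2 d : R, 0 < d & forall x, `|x - a| < d ->
    [/\ U x, `|'D_v ('D_u f) x - 'D_v ('D_u f) a| < e / 2 &
       `|'D_u ('D_v f) x - 'D_u ('D_v f) a| < e / 2].
  have nU : nbhs a U by apply: open_nbhs_nbhs.
  have /cvgrPdist_lt /(_ _ e2) n1 := cDD v u.
  have /cvgrPdist_lt /(_ _ e2) n2 := cDD u v.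
  have /nbhs_ballP [d d0 dP] : nbhs a (U `&` ([set x | `|'D_v ('D_u f) a - 'D_v ('D_u f) x| < e / 2]
      `&` [set x | `|'D_u ('D_v f) a - 'D_u ('D_v f) x| < e / 2])).
    exact: (filterI nU (filterI n1 n2)).
  exists d => // x xd; have [|Ux [x1 x2]] := dP x.
    by rewrite -ball_normE /= distrC.
  by split; [exact: Ux|rewrite distrC; exact: x1|rewrite distrC; exact: x2].
(* The step [s] satisfies [s * M = d / 2], so the whole parallelogram stays strictly within distance
   [d] of [a]; the summand 1 keeps [M] positive when [u] and [v] vanish. *)
pose M := `|u| + `|v| + 1; have M0 : 0 < M by rewrite ltr_wpDl // addr_ge0.
pose s := d / (2 * M).
have s0 : 0 < s by rewrite divr_gt0 // mulr_gt0.
have small p q : 0 <= p <= s -> 0 <= q <= s -> `|p *: u + q *: v| < d.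
  move=> /andP[p0 ps] /andP[q0 qs].
  apply: (@le_lt_trans _ _ (s * M)).
    rewrite (le_trans (ler_normD _ _)) // !normrZ !ger0_norm // /M -addrA !mulrDr.
    rewrite lerD // ?ler_wpM2r //.
    by rewrite ler_wpDr ?ler_wpM2r // mulr1 ltW.
  rewrite /s invfM mulrA mulrVK ?unitfE ?gt_eqF //.
  by rewrite ltr_pdivrMr // ltr_pMr // ltr1n.
have [] := @second_difference f U a u v s s0 _ Cf.
  move=> p q ps qs; have [|? _ _ //] := dP (a + p *: u + q *: v).
  by rewrite -(addrA a) (addrC a) addrK; apply: small.
move=> p [q [ps qs E1]].
have [] := @second_difference f U a v u s s0 _ Cf.
  move=> p' q' ps' qs'; have [|? _ _ //] := dP (a + p' *: v + q' *: u).
  by rewrite -(addrA a) (addrC a) addrK addrC; apply: small.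
move=> p' [q' [ps' qs' E2]].
have E : 'D_v ('D_u f) (a + p *: u + q *: v) = 'D_u ('D_v f) (a + p' *: v + q' *: u).
  have sn0 : s != 0 by rewrite gt_eqF.
  move: E1 E2; move: ('D_v ('D_u f) _) ('D_u ('D_v f) _) => B C E1 E2.
  apply: (mulfI sn0); apply: (mulfI sn0); rewrite -E1 -E2 (addrAC a (s *: u)).
  by congr (_ + _); apply: addrAC.
have [|_ h1 _] := dP (a + p *: u + q *: v).
  by rewrite -(addrA a) (addrC a) addrK; apply: small.
have [|_ _ h2] := dP (a + p' *: v + q' *: u).
  by rewrite -(addrA a) (addrC a) addrK addrC; apply: small.
apply: (@le_trans _ _ (e / 2 + e / 2)); last by rewrite -splitr.
rewrite -(subrKA ('D_v ('D_u f) (a + p *: u + q *: v))).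
apply: (le_trans (ler_normD _ _)); apply: lerD; apply: ltW.
  by rewrite distrC; exact: h1.
by rewrite E; exact: h2.
Qed.

End Schwarz.

(** * Multilinear forms *)

Section Updates.
Context {I : eqType} {X : Type}.
Implicit Types (al : I -> X) (i j : I) (a b : X).

Lemma with_same al i a b : [eta [eta al with i |-> a] with i |-> b]
  = [eta al with i |-> b] :> (I -> X).
Proof. by apply/funext => x /=; case: eqP. Qed.

Lemma with_id al i : [eta al with i |-> al i] = al :> (I -> X).
Proof. by apply/funext => x /=; case: eqP => [->|]. Qed.

Lemma with_comm al i j a b : i != j ->
  [eta [eta al with i |-> a] with j |-> b] = [eta [eta al with j |-> b] with i |-> a]
    :> (I -> X).
Proof.
move=> ij; apply/funext => x /=; case: (eqVneq x j) => [->|//].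
by rewrite eq_sym (negPf ij).
Qed.

End Updates.

Section Multilinear.
Context {R : realType} {n : nat}.

Definition slot_symmetric m (t : ('I_m -> 'rV[R]_n) -> R) :=
  forall al (s : {perm 'I_m}), t (al \o s) = t al.

Section Slots.
Context {m : nat} (t : ('I_m -> 'rV[R]_n) -> R) (tlin : multilinear t).
Implicit Types (al : 'I_m -> 'rV[R]_n) (i : 'I_m).

Lemma multilinear0 al i : t [eta al with i |-> 0] = 0.
Proof.
have := tlin al i 1 0 0; rewrite scale1r addr0 mul1r => /eqP.
by rewrite -subr_eq subrr => /eqP.
Qed.

Lemma multilinearD al i b b' :
  t [eta al with i |-> b + b'] = t [eta al with i |-> b] + t [eta al with i |-> b'].
Proof. by rewrite -(scale1r b) tlin mul1r scale1r. Qed.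

Lemma multilinearZ al i (a : R) b :
  t [eta al with i |-> a *: b] = a * t [eta al with i |-> b].
Proof. by rewrite -(addr0 (a *: b)) tlin multilinear0 addr0. Qed.

Lemma multilinearN al i b : t [eta al with i |-> - b] = - t [eta al with i |-> b].
Proof. by rewrite -scaleN1r multilinearZ mulN1r. Qed.

Lemma multilinearB al i b b' :
  t [eta al with i |-> b - b'] = t [eta al with i |-> b] - t [eta al with i |-> b'].
Proof. by rewrite multilinearD multilinearN. Qed.

Lemma multilinear_sum al i (J : Type) (r : seq J) (b : J -> 'rV[R]_n) :
  t [eta al with i |-> \sum_(j <- r) b j] = \sum_(j <- r) t [eta al with i |-> b j].
Proof.
elim: r => [|j r ih]; first by rewrite !big_nil multilinear0.
by rewrite !big_cons multilinearD ih.
Qed.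

Lemma multilinear_coord al i (b : 'rV[R]_n) :
  t [eta al with i |-> b] = \sum_(l < n) b 0 l * t [eta al with i |-> delta_mx 0 l].
Proof.
rewrite [in LHS](row_sum_delta b) multilinear_sum.
by apply: eq_bigr => l _; rewrite multilinearZ.
Qed.

Lemma multilinear_slot al i :
  t al = \sum_(l < n) al i 0 l * t [eta al with i |-> delta_mx 0 l].
Proof. by rewrite -multilinear_coord with_id. Qed.

End Slots.

Section Calculus.
Context {V : normedModType R} {m : nat}.
Context (t : V -> ('I_m -> 'rV[R]_n) -> R) (tlin : forall z, multilinear (t z)).

(** The form and its arguments vary together, while the smoothness of the form is known only on
    constant arguments. *)
Lemma Ck_multilinear (U : set V) k (al : 'I_m -> V -> 'rV[R]_n) : open U ->
  (forall b, Ck k U (fun z => t z b : R^o)) ->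
  (forall i l, Ck k U (fun z => al i z 0 l : R^o)) ->
  Ck k U (fun z => t z (fun i => al i z) : R^o).
Proof.
move=> oU tk alk.
(* Induction on the list [s] of slots that may vary. Expanding the head slot in the basis freezes it
   at a basis covector, at the cost of a scalar factor that depends on [z]. *)
suff h (s : seq 'I_m) (be : 'I_m -> V -> 'rV[R]_n) (a : 'I_m -> 'rV[R]_n) :
    (forall i l, Ck k U (fun z => be i z 0 l : R^o)) ->
    (forall i, i \notin s -> be i = cst (a i)) ->
    Ck k U (fun z => t z (fun i => be i z) : R^o).
  by apply: (h (enum 'I_m) al (fun=> 0) alk) => i; rewrite mem_enum.
elim: s be a => [|j s ih] be a bek bea.
  rewrite (_ : (fun _ => _) = fun z => t z a : R^o); first exact: tk.
  apply/funext => z; congr (t z _); apply/funext => i.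
  by rewrite bea.
rewrite (_ : (fun _ => _) = fun z => \sum_(l < n) be j z 0 l *
    t z (fun i => [eta be with j |-> cst (delta_mx 0 l)] i z)).
  apply: Ck_sum => // l; apply: CkM => //.
  apply: (ih _ [eta a with j |-> delta_mx 0 l]) => [i l'|i ns].
    by rewrite /=; case: eqP => _ //; apply: Ck_cst.
  by rewrite /=; case: eqP => // /eqP ij; apply: bea; rewrite inE negb_or ij.
apply/funext => z; rewrite (multilinear_slot (tlin z) _ j).
apply: eq_bigr => l _; congr (_ * t z _); apply/funext => i /=.
by case: eqP.
Qed.

(** Leibniz rule for a varying form in all its slots, by the same induction on the list of
    non-constant slots. *)
Lemma is_derive_multilinear z w (dt : ('I_m -> 'rV[R]_n) -> R)
    (al : 'I_m -> V -> 'rV[R]_n) (dal : 'I_m -> 'rV[R]_n) :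
  (forall b, is_derive z w (fun z => t z b : R^o) (dt b)) ->
  (forall i, is_derive z w (al i) (dal i)) ->
  is_derive z w (fun z => t z (fun i => al i z) : R^o)
   (dt (fun i => al i z) +
    \sum_(r < m) t z [eta (fun i => al i z) with r |-> dal r]).
Proof.
move=> tk alk.
(* [dt] is known only through its values as derivatives; it inherits multilinearity from [t], and
   this lets its slot [j] be expanded below. *)
have dtlin : multilinear dt.
  move=> b i a c c'.
  rewrite -(@derive_val _ _ _ _ _ _ _ (tk [eta b with i |-> a *: c + c'])).
  rewrite (_ : (fun z0 => _) = (a \*: (fun z => t z [eta b with i |-> c] : R^o)) \+
     (fun z => t z [eta b with i |-> c'] : R^o)).
    by rewrite deriveD ?deriveZ ?derive_val //; apply: derivableZ; apply: ex_derive.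
  by apply/funext => y; rewrite tlin.
suff h (s : seq 'I_m) (be : 'I_m -> V -> 'rV[R]_n) dbe (a : 'I_m -> 'rV[R]_n) :
    (forall i, is_derive z w (be i) (dbe i)) ->
    (forall i, i \notin s -> be i = cst (a i)) ->
    is_derive z w (fun z => t z (fun i => be i z) : R^o)
     (dt (fun i => be i z) +
      \sum_(r < m) t z [eta (fun i => be i z) with r |-> dbe r]).
  by apply: (h (enum 'I_m) al dal (fun=> 0) alk) => i; rewrite mem_enum.
elim: s be dbe a => [|j s ih] be dbe a dbek bea.
  have Ea y : (fun i => be i y) = a by apply/funext => i; rewrite bea.
  rewrite (_ : (fun _ => _) = fun z => t z a : R^o); last first.
    by apply/funext => y; rewrite Ea.
  apply: (is_derive_eq (tk a)); rewrite Ea big1 ?addr0 // => r _.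
  have [_ <-] := dbek r.
  by rewrite bea // derive_cst; apply: multilinear0.
rewrite (_ : (fun _ => _) = fun z => \sum_(l < n) be j z 0 l *
    t z (fun i => [eta be with j |-> cst (delta_mx 0 l)] i z)); last first.
  apply/funext => y; rewrite (multilinear_slot (tlin y) _ j).
  apply: eq_bigr => l _; congr (_ * t y _); apply/funext => i /=.
  by case: eqP.
have dl (l : 'I_n) := ih [eta be with j |-> cst (delta_mx 0 l)] [eta dbe with j |-> 0]
  [eta a with j |-> delta_mx 0 l].
have bel (l : 'I_n) i : is_derive z w ([eta be with j |-> cst (delta_mx 0 l)] i)
    ([eta dbe with j |-> 0] i).
  by rewrite /=; case: eqP => _; [exact: is_derive_cst|exact: dbek].
have bea' l i : i \notin s -> [eta be with j |-> cst (delta_mx 0 l)] i =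
    cst ([eta a with j |-> delta_mx 0 l] i).
  by move=> ns /=; case: eqP => // /eqP ij; apply: bea; rewrite inE negb_or ij.
have {}dl l := is_derive_mul (is_derive_coord 0 l (dbek j)) (dl l (bel l) (bea' l)).
apply: (is_derive_eq (is_derive_bigsum (index_enum 'I_n) dl)).
have El l : (fun i => (if i == j then cst (delta_mx 0 l) else be i) z) =
    [eta (fun i => be i z) with j |-> delta_mx 0 l].
  by apply/funext => i /=; case: eqP.
under eq_bigr => l _ do rewrite /= El.
rewrite big_split /= (multilinear_slot dtlin _ j) [in RHS](bigD1 j) //=.
rewrite [RHS]addrCA addrC; congr (_ + _).
  by rewrite (multilinear_coord (tlin z)); apply: eq_bigr => l _; rewrite mulrC.
under eq_bigr => l _ do rewrite mulrDr mulr_sumr.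
rewrite big_split /= exchange_big /= [X in _ + X = _](bigD1 j) //=.
rewrite [X in _ + (X + _) = _]big1 ?add0r => [|l _]; last first.
  by rewrite eqxx multilinear0 ?mulr0.
congr (_ + _); apply: eq_bigr => r rj; rewrite (negPf rj).
rewrite (multilinear_slot (tlin z) _ j) /= eq_sym (negPf rj).
by apply: eq_bigr => l _; rewrite with_comm // eq_sym.
Qed.

End Calculus.

Section Symmetric.
Context {m : nat} (t : ('I_m -> 'rV[R]_n) -> R) (tsym : slot_symmetric t).
Implicit Types (p b c : 'rV[R]_n) (i j : 'I_m).

Lemma with_perm (al : 'I_m -> 'rV[R]_n) i b (s : {perm 'I_m}) :
  [eta al with s i |-> b] \o s = [eta al \o s with i |-> b]
  :> ('I_m -> 'rV[R]_n).
Proof. by apply/funext => x /=; rewrite (inj_eq perm_inj). Qed.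

Lemma symmetric_with1 p b i j :
  t [eta (fun=> p) with i |-> b] = t [eta (fun=> p) with j |-> b].
Proof.
rewrite -(tsym _ (tperm j i)) -[X in [eta _ with X |-> _] \o _](tpermL j i).
by rewrite with_perm.
Qed.

Lemma symmetric_with2 p b c i j i' j' : i != j -> i' != j' ->
  t [eta [eta (fun=> p) with i |-> b] with j |-> c] =
  t [eta [eta (fun=> p) with i' |-> b] with j' |-> c].
Proof.
move=> ij ij'; set s := tperm j' j.
(* Two transpositions suffice: the first carries [j] to [j'], the second carries the image of [i] to
   [i'] and fixes [j']. *)
have E1 k : t [eta [eta (fun=> p) with k |-> b] with j |-> c] =
    t [eta [eta (fun=> p) with s k |-> b] with j' |-> c].
  rewrite -(tsym _ s) -[X in [eta _ with X |-> c]](tpermL j' j) with_perm.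
  by rewrite -{1}(tpermK j' j k) -/s with_perm.
rewrite E1; set k := s i; have kj : k != j'.
  by rewrite /k -(tpermR j' j) -/s (inj_eq perm_inj).
rewrite -(tsym _ (tperm i' k)).
rewrite -[X in [eta _ with X |-> c]](@tpermD _ i' k j') // with_perm.
by rewrite -[X in [eta _ with X |-> b]](tpermL i' k) with_perm.
Qed.

End Symmetric.

Lemma cov_cons0 m (b : 'rV[R]_n) (al : 'I_m -> 'rV[R]_n) : cov_cons b al ord0 = b.
Proof. by rewrite /cov_cons unlift_none. Qed.

Lemma cov_consS m (b : 'rV[R]_n) (al : 'I_m -> 'rV[R]_n) i :
  cov_cons b al (lift ord0 i) = al i.
Proof. by rewrite /cov_cons liftK. Qed.

Lemma cov_cons_eq m (b : 'rV[R]_n) (al : 'I_m -> 'rV[R]_n) be :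
  be ord0 = b -> (forall i, be (lift ord0 i) = al i) -> be = cov_cons b al.
Proof.
move=> h0 hS; apply/funext => i; have [j ->|->] := unliftP ord0 i.
  by rewrite hS cov_consS.
by rewrite h0 cov_cons0.
Qed.

Lemma cov_cons_head_tail m (al : 'I_m.+1 -> 'rV[R]_n) :
  al = cov_cons (al ord0) (fun i => al (lift ord0 i)).
Proof. exact: cov_cons_eq. Qed.

Lemma cov_cons_with m (b c : 'rV[R]_n) (al : 'I_m -> 'rV[R]_n) i :
  cov_cons b [eta al with i |-> c] = [eta cov_cons b al with lift ord0 i |-> c]
  :> ('I_m.+1 -> 'rV[R]_n).
Proof.
apply/esym/cov_cons_eq => [|j] /=.
  by rewrite cov_cons0.
by rewrite (inj_eq lift_inj) cov_consS.
Qed.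

Lemma with_ord0 m (b c : 'rV[R]_n) (al : 'I_m -> 'rV[R]_n) :
  [eta cov_cons b al with ord0 |-> c] = cov_cons c al :> ('I_m.+1 -> 'rV[R]_n).
Proof.
by apply/cov_cons_eq => [|j] //=; rewrite cov_consS.
Qed.

Lemma cov_cons_const m (p : 'rV[R]_n) : cov_cons p (fun _ : 'I_m => p) = fun=> p.
Proof. by apply/esym/cov_cons_eq. Qed.

Lemma multilinear_cons m (t : ('I_m.+1 -> 'rV[R]_n) -> R) b :
  multilinear t -> multilinear (fun al => t (cov_cons b al)).
Proof. by move=> tlin al i a c c'; rewrite !cov_cons_with tlin. Qed.

(** A permutation of the remaining slots extends to all slots by fixing the first one. *)
Lemma symmetric_cons m (t : ('I_m.+1 -> 'rV[R]_n) -> R) b :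
  slot_symmetric t -> slot_symmetric (fun al => t (cov_cons b al)).
Proof.
move=> tsym al s; rewrite -[RHS](tsym _ (lift_perm ord0 ord0 s)); congr t.
apply/esym/cov_cons_eq => [|i] /=; first by rewrite lift_perm_id cov_cons0.
by rewrite lift_perm_lift cov_consS.
Qed.

(* Differentiating [t (p + r b, ..., p + r b) = 0] at [r = 0] isolates
   [t (b, p, ..., p)], so that the slots can be freed one by one. *)
Lemma polarization m (t : ('I_m -> 'rV[R]_n) -> R) :
  multilinear t -> slot_symmetric t -> (forall p, t (fun=> p) = 0) ->
  forall al, t al = 0.
Proof.
elim: m t => [|m ih] t tlin tsym t0 al.
  by rewrite -(t0 0); congr t; apply/funext => -[].
rewrite [al]cov_cons_head_tail.
set be := fun i => _; move: (al ord0) be => b be.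
apply: (ih (fun al => t (cov_cons b al))).
- exact: multilinear_cons.
- exact: symmetric_cons.
move=> p.
have := is_derive_multilinear (fun _ : R^o => tlin)
  (fun a => is_derive_cst (t a : R^o) (0 : R^o) (1 : R^o))
  (fun _ : 'I_m.+1 => is_derive_affine p b 0).
rewrite (_ : (fun _ => _) = cst 0); last by apply/funext => r; apply: t0.
case=> _; rewrite derive_cst add0r scale0r addr0 => /esym.
rewrite (eq_bigr (fun=> t (cov_cons b (fun=> p)))) => [|r _]; last first.
  by rewrite (symmetric_with1 tsym p b r ord0) -cov_cons_const with_ord0.
by rewrite sumr_const card_ord => /eqP; rewrite mulrn_eq0 /= => /eqP.
Qed.

End Multilinear.

(** * Charts *)

Section Pairing.
Context {R : realType} {n : nat}.
Implicit Types a b v w : 'rV[R]_n.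

Lemma pairingE a v : pairing a v = \sum_(j < n) a 0 j * v 0 j.
Proof. by rewrite /pairing mxE; apply: eq_bigr => j _; rewrite mxE. Qed.

Lemma pairingDl a b v : pairing (a + b) v = pairing a v + pairing b v.
Proof. by rewrite /pairing mulmxDl mxE. Qed.

Lemma pairingZl (k : R) a v : pairing (k *: a) v = k * pairing a v.
Proof. by rewrite /pairing -scalemxAl mxE. Qed.

Lemma pairingC a v : pairing a v = pairing v a.
Proof. by rewrite !pairingE; apply: eq_bigr => j _; rewrite mulrC. Qed.

Lemma pairingNl a v : pairing (- a) v = - pairing a v.
Proof. by rewrite -scaleN1r pairingZl mulN1r. Qed.

Lemma pairing0l v : pairing 0 v = 0.
Proof. by rewrite /pairing mul0mx mxE. Qed.

Lemma pairing_suml (I : Type) (r : seq I) (a : I -> 'rV[R]_n) v :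
  pairing (\sum_(i <- r) a i) v = \sum_(i <- r) pairing (a i) v.
Proof. by rewrite /pairing mulmx_suml summxE. Qed.

Lemma pairing_delta a j : pairing a (delta_mx 0 j) = a 0 j.
Proof.
rewrite pairingE (bigD1 j) //= big1 => [|i ij]; last by rewrite !mxE (negPf ij) mulr0.
by rewrite !mxE !eqxx mulr1 addr0.
Qed.

Lemma pairing_mulmx (u v : 'rV[R]_n) (M : 'M[R]_n) :
  \sum_(i < n) \sum_(j < n) u 0 i * (M i j * v 0 j) = pairing (u *m M) v.
Proof.
rewrite /pairing -mulmxA mxE; apply: eq_bigr => i _.
rewrite -mulr_sumr; congr (_ * _); rewrite [RHS]mxE.
by apply: eq_bigr => j _; rewrite [X in _ = _ * X]mxE.
Qed.

Lemma pairing_inj a b : (forall v, pairing a v = pairing b v) -> a = b.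
Proof. by move=> h; apply/rowP => j; rewrite -!pairing_delta h. Qed.

Lemma pairing_covector_of (l : {linear 'rV[R]_n -> R^o}) v :
  pairing (covector_of l) v = l v.
Proof.
rewrite pairingE {2}(row_sum_delta v) linear_sum; apply: eq_bigr => j _.
by rewrite linearZ mxE mulrC.
Qed.

Lemma pairing_covector_of_fun (l : 'rV[R]_n -> R) v : linear (l : _ -> R^o) ->
  pairing (covector_of l) v = l v.
Proof.
move=> ll; pose lL := GRing.isLinear.Build _ _ _ _ (l : _ -> R^o) ll.
pose L : {linear 'rV[R]_n -> R^o} := HB.pack (l : 'rV[R]_n -> R^o) lL.
exact: (pairing_covector_of L).
Qed.

End Pairing.

Section ChartChange.
Context {R : realType} {n : nat} {M : Type}.

(** Chain rule through a second chart. [M] is a bare type, so that the rule serves for [Q] and also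
    for the cotangent bundle with its natural charts, which is given no topology. *)
Lemma diff_chart_change (W : normedModType R) (c d : @chart R n M) (F : M -> W) x :
  (\near x, cinv d (cmap d (cinv c x)) = cinv c x) ->
  differentiable (cmap d \o cinv c) x ->
  differentiable (F \o cinv d) (cmap d (cinv c x)) ->
  differentiable (F \o cinv c) x /\
  'd (F \o cinv c) x =
    'd (F \o cinv d) (cmap d (cinv c x)) \o 'd (cmap d \o cinv c) x :> (_ -> _).
Proof.
move=> dc dt dF.
have E : \near x, ((F \o cinv d) \o (cmap d \o cinv c)) x = (F \o cinv c) x.
  by apply: filterS dc => y /= ->.
have dcomp : differentiable ((F \o cinv d) \o (cmap d \o cinv c)) x.
  exact: differentiable_comp.
split; first exact: near_eq_differentiable E dcomp.
exact: (etrans (@near_eq_diff R _ _ ((F \o cinv d) \o (cmap d \o cinv c)) (F \o cinv c) x E dcomp) (diff_comp dt dF)).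
Qed.

End ChartChange.

Section Charts.
Context {R : realType} {n : nat} {Q : topologicalType} {A : @charted R n Q}.
Context (hQ : smooth_manifold A).
Implicit Types (c d : @chart R n Q) (q : Q) (x v a p : 'rV[R]_n).

Lemma chart_at_atlas q : atlas A (chart_at A q).
Proof. by have [] := sm_chart_at hQ q. Qed.

Lemma chart_at_dom q : cdom (chart_at A q) q.
Proof. by have [] := sm_chart_at hQ q. Qed.

Lemma cimg_cmap c q : cdom c q -> cimg c (cmap c q).
Proof. by move=> cq; exists q. Qed.

Lemma cinv_dom c x : atlas A c -> cimg c x -> cdom c (cinv c x).
Proof. by move=> Ac [q cq <-]; rewrite (sm_cancel hQ Ac). Qed.

Lemma cinvK c x : atlas A c -> cimg c x -> cmap c (cinv c x) = x.
Proof. by move=> Ac [q cq <-]; rewrite (sm_cancel hQ Ac). Qed.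

Lemma near_cimg c x : atlas A c -> cimg c x -> \near x, cimg c x.
Proof. by move=> Ac cx; apply: open_nbhs_nbhs; split=> //; apply: (sm_img_open hQ). Qed.

Lemma near_cdom c d x : atlas A c -> atlas A d -> cimg c x -> cdom d (cinv c x) ->
  \near x, cdom d (cinv c x).
Proof.
move=> Ac Ad cx dx; apply: (sm_inv_cont hQ Ac cx).
by apply: open_nbhs_nbhs; split=> //; apply: (sm_dom_open hQ).
Qed.

Lemma near_cancel c d x : atlas A c -> atlas A d -> cimg c x -> cdom d (cinv c x) ->
  \near x, cinv d (cmap d (cinv c x)) = cinv c x.
Proof.
move=> Ac Ad cx dx; apply: filterS (near_cdom Ac Ad cx dx) => y dy.
exact: (sm_cancel hQ).
Qed.

Lemma overlap c d x : atlas A c -> cimg c x -> cdom d (cinv c x) ->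
  (cmap c @` (cdom c `&` cdom d)) x.
Proof.
by move=> Ac cx dx; exists (cinv c x); [split=> //; apply: cinv_dom|apply: cinvK].
Qed.

Lemma transition_differentiable c d x : atlas A c -> atlas A d -> cimg c x ->
  cdom d (cinv c x) -> differentiable (cmap d \o cinv c) x.
Proof.
move=> Ac Ad cx dx; have [+ _] := sm_compat hQ Ac Ad 1.
by apply; apply: overlap.
Qed.

Lemma transition_derive_differentiable c d x v : atlas A c -> atlas A d ->
  cimg c x -> cdom d (cinv c x) -> differentiable ('D_v (cmap d \o cinv c)) x.
Proof.
move=> Ac Ad cx dx; have [_ /(_ v) [+ _]] := sm_compat hQ Ac Ad 2.
by apply; apply: overlap.
Qed.

Lemma diff_change (W : normedModType R) c d (F : Q -> W) x : atlas A c -> atlas A d ->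
  cimg c x -> cdom d (cinv c x) ->
  differentiable (F \o cinv d) (cmap d (cinv c x)) ->
  differentiable (F \o cinv c) x /\
  'd (F \o cinv c) x =
    'd (F \o cinv d) (cmap d (cinv c x)) \o 'd (cmap d \o cinv c) x :> (_ -> _).
Proof.
move=> Ac Ad cx dx; apply: diff_chart_change; first exact: near_cancel.
exact: transition_differentiable.
Qed.

Lemma diff_transition_id c x v : atlas A c -> cimg c x ->
  'd (cmap c \o cinv c) x v = v.
Proof.
move=> Ac cx; have E : \near x, id x = (cmap c \o cinv c) x.
  by apply: filterS (near_cimg Ac cx) => y cy /=; rewrite cinvK.
have := near_eq_diff E (@ex_diff _ _ _ _ _ _ _ (is_diff_id x)).
by move=> ->; rewrite diff_val.
Qed.

(** Cocycle identity of the differentials of transition maps; the mutual inverseness of [to_chart]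
    and [of_chart] comes from it. *)
Lemma diff_transition_comp (c d e : @chart R n Q) q v :
  atlas A c -> atlas A d -> atlas A e -> cdom c q -> cdom d q -> cdom e q ->
  'd (cmap e \o cinv d) (cmap d q) ('d (cmap d \o cinv c) (cmap c q) v) =
  'd (cmap e \o cinv c) (cmap c q) v.
Proof.
move=> Ac Ad Ae cq dq eq.
have qc : cinv c (cmap c q) = q by apply: (sm_cancel hQ).
have qd : cinv d (cmap d q) = q by apply: (sm_cancel hQ).
have cq' := cimg_cmap cq.
have dq' : cdom d (cinv c (cmap c q)) by rewrite qc.
have dF : differentiable (cmap e \o cinv d) (cmap d (cinv c (cmap c q))).
  by rewrite qc; apply: transition_differentiable; rewrite ?qd //; apply: cimg_cmap.
have [_ /(congr1 (fun f => f v)) E] := diff_change Ac Ad cq' dq' dF.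
by rewrite qc in E; exact: (esym E).
Qed.

Lemma to_chartK c q v : atlas A c -> cdom c q -> of_chart A c q (to_chart A c q v) = v.
Proof.
move=> Ac cq; rewrite /of_chart /to_chart diff_transition_comp //.
- by apply: diff_transition_id; [exact: chart_at_atlas|apply/cimg_cmap/chart_at_dom].
- exact: chart_at_atlas.
- exact: chart_at_atlas.
- exact: chart_at_dom.
- exact: chart_at_dom.
Qed.

Lemma of_chartK c q v : atlas A c -> cdom c q -> to_chart A c q (of_chart A c q v) = v.
Proof.
move=> Ac cq; rewrite /of_chart /to_chart diff_transition_comp //.
- by apply: diff_transition_id; last exact: cimg_cmap.
- exact: chart_at_atlas.
- exact: chart_at_dom.
Qed.

Lemma to_chart_centre q v : to_chart A (chart_at A q) q v = v.
Proof.
by apply: diff_transition_id; [exact: chart_at_atlas|apply/cimg_cmap/chart_at_dom].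
Qed.

Lemma of_chart_centre q v : of_chart A (chart_at A q) q v = v.
Proof. exact: to_chart_centre. Qed.

Lemma pairing_cov_of_chart c q p v :
  pairing (cov_of_chart A c q p) v = pairing p (to_chart A c q v).
Proof.
rewrite /cov_of_chart pairing_covector_of_fun // => k u w.
by rewrite /to_chart linearP pairingC pairingDl pairingZl !(pairingC _ p).
Qed.

Lemma pairing_cov_to_chart c q a v :
  pairing (cov_to_chart A c q a) v = pairing a (of_chart A c q v).
Proof.
rewrite /cov_to_chart pairing_covector_of_fun // => k u w.
by rewrite /of_chart linearP pairingC pairingDl pairingZl !(pairingC _ a).
Qed.

Lemma cov_of_chartP c q (k : R) p p' : cov_of_chart A c q (k *: p + p') =
  k *: cov_of_chart A c q p + cov_of_chart A c q p'.
Proof.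
apply: pairing_inj => v.
by rewrite pairingDl pairingZl !pairing_cov_of_chart pairingDl pairingZl.
Qed.

Lemma cov_to_chartK c q a : atlas A c -> cdom c q ->
  cov_of_chart A c q (cov_to_chart A c q a) = a.
Proof.
move=> Ac cq; apply: pairing_inj => v.
by rewrite pairing_cov_of_chart pairing_cov_to_chart to_chartK.
Qed.

Lemma cov_of_chartK c q p : atlas A c -> cdom c q ->
  cov_to_chart A c q (cov_of_chart A c q p) = p.
Proof.
move=> Ac cq; apply: pairing_inj => v.
by rewrite pairing_cov_to_chart pairing_cov_of_chart of_chartK.
Qed.

Lemma cov_of_chart_centre q p : cov_of_chart A (chart_at A q) q p = p.
Proof. by apply: pairing_inj => v; rewrite pairing_cov_of_chart to_chart_centre. Qed.

Lemma cov_to_chart_centre q p : cov_to_chart A (chart_at A q) q p = p.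
Proof. by apply: pairing_inj => v; rewrite pairing_cov_to_chart of_chart_centre. Qed.

Lemma d0_of_chart (f : Q -> R) c q v : smooth_fun A f -> atlas A c -> cdom c q ->
  d0 A f q (of_chart A c q v) = 'd (f \o cinv c : _ -> R^o) (cmap c q) v.
Proof.
move=> sf Ac cq; rewrite /d0 /of_chart.
have Aq := chart_at_atlas q; have dq := chart_at_dom q.
have qc : cinv c (cmap c q) = q by apply: (sm_cancel hQ).
have cq' := cimg_cmap cq.
have dq' : cdom (chart_at A q) (cinv c (cmap c q)) by rewrite qc.
have df : differentiable (f \o cinv (chart_at A q) : _ -> R^o)
    (cmap (chart_at A q) (cinv c (cmap c q))).
  by rewrite qc; have [+ _] := sf _ Aq 1; apply; apply: cimg_cmap.
have [_ /(congr1 (fun f => f v)) E] := diff_change Ac Aq cq' dq' df.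
by rewrite qc in E; exact: (esym E).
Qed.

Section Natural.
Implicit Types (m : @cotangent R n Q) (z w : 'rV[R]_(n + n)).
Local Notation nat_chart c := (natural_chart A c).

Lemma natural_cancel c m : atlas A c -> cdom c (foot m) ->
  cinv (nat_chart c) (cmap (nat_chart c) m) = m.
Proof.
case: m => q a Ac /= cq; rewrite row_mxKl row_mxKr (sm_cancel hQ) //.
by rewrite cov_to_chartK.
Qed.

Lemma natural_cinvK c z : atlas A c -> cimg c (lsubmx z) ->
  cmap (nat_chart c) (cinv (nat_chart c) z) = z.
Proof.
move=> Ac cz /=; rewrite cinvK // cov_of_chartK ?hsubmxK //.
exact: cinv_dom.
Qed.

Lemma near_lsubmx (P : set 'rV[R]_n) z :
  (\forall y \near lsubmx z, P y) -> \forall y \near z, P (lsubmx y).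
Proof. by move=> h; apply: (@continuous_lsubmx R 1 n n z). Qed.

Lemma natural_near_cancel c d z : atlas A c -> atlas A d -> cimg c (lsubmx z) ->
  cdom d (cinv c (lsubmx z)) ->
  \near z, cinv (nat_chart d) (cmap (nat_chart d) (cinv (nat_chart c) z)) =
           cinv (nat_chart c) z.
Proof.
move=> Ac Ad cz dz.
apply: filterS (near_lsubmx (near_cdom Ac Ad cz dz)) => y dy.
exact: natural_cancel.
Qed.

(** [cov_of_chart] and [cov_to_chart] both go through the preferred chart of the moving foot point,
    which may jump. By the cocycle identity that chart cancels, and what is left involves only the
    transitions between [c] and [d], so its dependence on [z] can be differentiated. *)
Lemma natural_transitionE c d z : atlas A c -> atlas A d -> cimg c (lsubmx z) ->
  cdom d (cinv c (lsubmx z)) ->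
  cmap (nat_chart d) (cinv (nat_chart c) z) =
  row_mx ((cmap d \o cinv c) (lsubmx z))
    (\row_j pairing (rsubmx z)
      ('D_(delta_mx 0 j) (cmap c \o cinv d) ((cmap d \o cinv c) (lsubmx z)))).
Proof.
move=> Ac Ad cz dz; rewrite /=; congr row_mx.
have cz' := cinv_dom Ac cz.
apply: pairing_inj => v; rewrite pairing_cov_to_chart pairing_cov_of_chart.
rewrite /to_chart /of_chart diff_transition_comp //.
- have dt : differentiable (cmap c \o cinv d) (cmap d (cinv c (lsubmx z))).
    by apply: transition_differentiable; rewrite ?(sm_cancel hQ) //; apply: cimg_cmap.
  rewrite -deriveE // pairingC.
  rewrite (_ : \row_j _ = covector_of (fun w : 'rV[R]_n => pairing (rsubmx z)
      ('d (cmap c \o cinv d) (cmap d (cinv c (lsubmx z))) w))); last first.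
    by apply/rowP => j; rewrite !mxE deriveE.
  rewrite pairing_covector_of_fun; first by rewrite pairingC deriveE.
  by move=> k u w'; rewrite linearP pairingC pairingDl pairingZl !(pairingC _ (rsubmx z)).
- exact: chart_at_atlas.
- exact: chart_at_dom.
Qed.

(** The momentum components contain first derivatives of a base transition map, so differentiability
    here costs two derivatives on the base. *)
Lemma natural_transition_differentiable c d z : atlas A c -> atlas A d ->
  cimg c (lsubmx z) -> cdom d (cinv c (lsubmx z)) ->
  differentiable (cmap (nat_chart d) \o cinv (nat_chart c)) z.
Proof.
move=> Ac Ad cz dz.
pose t (z : 'rV[R]_(n + n)) := (cmap d \o cinv c) (lsubmx z).
pose F z := row_mx (t z)
    (\row_j pairing (rsubmx z) ('D_(delta_mx 0 j) (cmap c \o cinv d) (t z))).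
apply: (@near_eq_differentiable _ _ _ F).
  apply: filterS (near_lsubmx (filterI (near_cimg Ac cz) (near_cdom Ac Ad cz dz))).
  by move=> y [cy dy]; exact: (esym (natural_transitionE Ac Ad cy dy)).
have dt : differentiable t z.
  apply: (@differentiable_comp _ _ _ _ lsubmx (cmap d \o cinv c)).
    exact: differentiable_lsubmx.
  exact: transition_differentiable.
have dcoord k : differentiable (fun z : 'rV[R]_(n + n) => rsubmx z 0 k : R^o) z.
  apply: (@differentiable_comp _ _ _ _ rsubmx (fun x : 'rV[R]_n => x 0 k)).
    exact: differentiable_rsubmx.
  exact: differentiable_coord.
apply: differentiable_rV => j; case: (split_ordP j) => i ->.
  rewrite (_ : (fun y => _) = (fun x : 'rV[R]_n => x 0 i) \o t); last first.
    by apply/funext => y; rewrite /F row_mxEl.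
  by apply: differentiable_comp => //; apply: differentiable_coord.
rewrite (_ : (fun y => _) = \sum_(k < n) ((fun y : 'rV[R]_(n + n) => rsubmx y 0 k : R^o) *
   ((fun x : 'rV[R]_n => x 0 k : R^o) \o
      ('D_(delta_mx 0 i) (cmap c \o cinv d) \o t)))); last first.
  apply/funext => y; rewrite /F row_mxEr mxE pairingE fct_sumE.
  by apply: eq_bigr.
apply: differentiable_sum => k; apply: differentiableM => //.
apply: differentiable_comp; last exact: differentiable_coord.
apply: differentiable_comp => //.
have cz' := cinv_dom Ac cz.
apply: transition_derive_differentiable; rewrite /t /= ?(sm_cancel hQ) //.
exact: cimg_cmap.
Qed.

(** Natural charts project to base charts. Hence a horizontal form on the cotangent bundle changes
    chart through the base transition alone. *)
Lemma lsubmx_natural_transition c d z w : atlas A c -> atlas A d ->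
  cimg c (lsubmx z) -> cdom d (cinv c (lsubmx z)) ->
  lsubmx ('d (cmap (nat_chart d) \o cinv (nat_chart c)) z w) =
  'd (cmap d \o cinv c) (lsubmx z) (lsubmx w).
Proof.
move=> Ac Ad cz dz.
have E : lsubmx \o (cmap (nat_chart d) \o cinv (nat_chart c)) =
    (cmap d \o cinv c) \o lsubmx by apply/funext => y /=; rewrite row_mxKl.
have dl (v : 'rV[R]_(n + n)) :
    'd (lsubmx : 'rV[R]_(n + n) -> 'rV[R]_n) v = lsubmx :> (_ -> _).
  by rewrite diff_lin //; apply: continuous_lsubmx.
have /(congr1 (fun f => f w)) E1 := diff_comp (natural_transition_differentiable Ac Ad cz dz)
  (@differentiable_lsubmx R 1 n n _).
have /(congr1 (fun f => f w)) E2 := diff_comp (@differentiable_lsubmx R 1 n n z)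
  (transition_differentiable Ac Ad cz dz).
have F1 := congr1 (fun f => f ('d (cmap (nat_chart d) \o cinv (nat_chart c)) z w))
  (dl ((cmap (nat_chart d) \o cinv (nat_chart c)) z)).
have F2 : 'd (cmap d \o cinv c) (lsubmx z) ('d (lsubmx : 'rV[R]_(n + n) -> 'rV[R]_n) z w)
    = 'd (cmap d \o cinv c) (lsubmx z) (lsubmx w) by rewrite dl.
apply: (etrans (esym F1)); apply: (etrans (esym E1)).
by apply: (etrans _ F2); apply: (etrans _ E2); apply: (congr1 (fun f => 'd f z w) E).
Qed.

End Natural.
End Charts.

(** * Coordinate expressions *)

Section LocalRepresentation.
Context {R : realType} {n : nat} {Q : topologicalType} {A : @charted R n Q}.
Context (hQ : smooth_manifold A) {g : Q -> 'M[R]_n} (hg : semi_riemannian A g).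
Implicit Types (c : @chart R n Q) (q : Q) (x v w a p : 'rV[R]_n) (z : 'rV[R]_(n + n)).
Local Notation nat_chart c := (natural_chart A c).

Lemma gform_linearl (G : 'M[R]_n) w : linear (fun v => gform G v w : R^o).
Proof. by move=> k u v; rewrite /gform mulmxDl -scalemxAl mulmxDl -scalemxAl !mxE. Qed.

Lemma gform_linearr (G : 'M[R]_n) w : linear (fun v => gform G w v : R^o).
Proof. by move=> k u v; rewrite /gform linearP /= mulmxDr -scalemxAr !mxE. Qed.

Lemma gform_pairing (G : 'M[R]_n) v w : gform G v w = pairing (v *m G) w.
Proof. by []. Qed.

(** [g q] refers to the preferred chart at [q] and need not be a continuous matrix function of [q];
    the components in a fixed chart [c] are smooth functions of the coordinates. *)
Definition gram c x : 'M[R]_n := \matrix_(i, j)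
  gform (g (cinv c x)) (of_chart A c (cinv c x) (delta_mx 0 i))
    (of_chart A c (cinv c x) (delta_mx 0 j)).

Lemma gram_form c x v w : gform (gram c x) v w =
  gform (g (cinv c x)) (of_chart A c (cinv c x) v) (of_chart A c (cinv c x) w).
Proof.
set q := cinv c x; set G := g q.
pose B u u' := gform G (of_chart A c q u) (of_chart A c q u').
have Bl u' : linear (fun u => B u u' : R^o).
  by move=> k u u0; rewrite /B /of_chart linearP gform_linearl.
have Br u : linear (fun u' => B u u' : R^o).
  by move=> k u' u0; rewrite /B /of_chart linearP gform_linearr.
rewrite -[RHS]/(B v w) -(pairing_covector_of_fun v (Bl w)) pairingE.
rewrite /gform -mulmxA mxE; apply: eq_bigr => i _; rewrite [RHS]mulrC; congr (_ * _).
rewrite !mxE -(pairing_covector_of_fun w (Br _)) pairingE.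
by apply: eq_bigr => j _; rewrite !mxE.
Qed.

Lemma gram_smooth c i j : atlas A c ->
  smooth_on (cimg c) (fun x => gram c x i j : R^o).
Proof.
move=> Ac k; have := sr_smooth hg Ac (delta_mx 0 i) (delta_mx 0 j) k.
by congr (Ck _ _); apply/funext => x; rewrite mxE.
Qed.

Lemma gram_centre q : gram (chart_at A q) (cmap (chart_at A q) q) = g q.
Proof.
apply/matrixP => i j; rewrite mxE (sm_cancel hQ (chart_at_atlas hQ q) (chart_at_dom hQ q)).
rewrite !(of_chart_centre hQ) gform_pairing pairing_delta.
by rewrite -rowE mxE.
Qed.

Lemma flat_of_chart c x v : atlas A c -> cimg c x ->
  flat g (cinv c x) (of_chart A c (cinv c x) v) =
  cov_of_chart A c (cinv c x) (v *m gram c x).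
Proof.
move=> Ac cx; apply: pairing_inj => u; rewrite pairing_cov_of_chart.
rewrite -gform_pairing gram_form (to_chartK hQ) //; exact: (cinv_dom hQ).
Qed.

Lemma flat_linear q (k : R) u v : flat g q (k *: u + v) = k *: flat g q u + flat g q v.
Proof. by rewrite /flat mulmxDl -scalemxAl. Qed.

Lemma flatK q v : sharp g q (flat g q v) = v.
Proof. by rewrite /flat /sharp mulmxK //; apply: (sr_nondegenerate hg). Qed.

Lemma sharpK q a : flat g q (sharp g q a) = a.
Proof. by rewrite /flat /sharp mulmxKV //; apply: (sr_nondegenerate hg). Qed.

Definition dchart (V : Q -> R) c x : 'rV[R]_n :=
  covector_of ('d (V \o cinv c : _ -> R^o) x).

Lemma pairing_dchart (V : Q -> R) c x v :
  pairing (dchart V c x) v = 'd (V \o cinv c : _ -> R^o) x v.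
Proof. exact: pairing_covector_of. Qed.

Lemma pairing_d_cov (V : Q -> R) q v : pairing (d_cov A V q) v = d0 A V q v.
Proof. exact: pairing_covector_of. Qed.

Lemma d_cov_chart (V : Q -> R) c x : smooth_fun A V -> atlas A c -> cimg c x ->
  d_cov A V (cinv c x) = cov_of_chart A c (cinv c x) (dchart V c x).
Proof.
move=> sV Ac cx; have cq := cinv_dom hQ Ac cx.
apply: pairing_inj => u; rewrite pairing_d_cov pairing_cov_of_chart pairing_dchart.
rewrite -[in LHS](to_chartK hQ u Ac cq) (d0_of_chart hQ _ sV Ac cq).
by rewrite (cinvK hQ Ac cx).
Qed.

Lemma dchart_smooth (V : Q -> R) c l : smooth_fun A V -> atlas A c ->
  smooth_on (cimg c) (fun x => dchart V c x 0 l : R^o).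
Proof.
move=> sV Ac k; have [dV DV] := sV _ Ac k.+1.
apply: Ck_ext (DV (delta_mx 0 l)) => [|x cx]; first exact: (sm_img_open hQ).
by rewrite mxE deriveE //; apply: dV.
Qed.

Section Tensors.
Context {m : nat} (T : tensor R n Q m) (hT : tensor_field A T).

Lemma tensor_in_chart_multilinear c x :
  multilinear (fun al => tensor_in_chart A c T al x).
Proof.
have E (al : 'I_m -> 'rV[R]_n) i b :
    (fun j => cov_of_chart A c (cinv c x) ([eta al with i |-> b] j)) =
    [eta (fun j => cov_of_chart A c (cinv c x) (al j)) with
      i |-> cov_of_chart A c (cinv c x) b].
  by apply/funext => j /=; case: eqP.
by move=> al i k b b'; rewrite /tensor_in_chart !E cov_of_chartP (tf_multilinear hT).
Qed.

Lemma tensor_in_chart_centre q al :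
  tensor_in_chart A (chart_at A q) T al (cmap (chart_at A q) q) = T q al.
Proof.
rewrite /tensor_in_chart (sm_cancel hQ (chart_at_atlas hQ q) (chart_at_dom hQ q)).
by congr (T q _); apply/funext => i; rewrite (cov_of_chart_centre hQ).
Qed.

End Tensors.

Definition natural_dom c : set 'rV[R]_(n + n) := [set z | cimg c (lsubmx z)].

Lemma natural_dom_open c : atlas A c -> open (natural_dom c).
Proof.
move=> Ac; apply: (@open_comp _ _ (lsubmx : 'rV[R]_(n + n) -> 'rV[R]_n) (cimg c)).
  by move=> z _; apply: continuous_lsubmx.
exact: (sm_img_open hQ).
Qed.

Lemma Ck_lsubmx (W : normedModType R) c k (f : 'rV[R]_n -> W) :
  Ck k (cimg c) f -> Ck k (natural_dom c) (fun z => f (lsubmx z)).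
Proof.
have cl : continuous (lsubmx : 'rV[R]_(n + n) -> 'rV[R]_n).
  exact: continuous_lsubmx.
by move=> Cf; apply: (@Ck_comp_linear _ _ _ _ lsubmx (cimg c)).
Qed.

Lemma Ck_rsubmx c k i : Ck k (natural_dom c) (fun z => rsubmx z 0 i : R^o).
Proof.
have L : linear (fun z : 'rV[R]_(n + n) => rsubmx z 0 i : R^o).
  by move=> a u v; rewrite linearP !mxE.
pose lL := GRing.isLinear.Build _ _ _ _ (fun z : 'rV[R]_(n + n) => rsubmx z 0 i : R^o) L.
pose LL : {linear 'rV[R]_(n + n) -> R^o} :=
  HB.pack (fun z : 'rV[R]_(n + n) => rsubmx z 0 i : R^o) lL.
exact: (Ck_linear LL).
Qed.

Lemma Ck_scale (V' : normedModType R) (U : set V') k (a : R) (f : V' -> R^o) :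
  open U -> Ck k U f -> Ck k U (fun y => a * f y : R^o).
Proof. by move=> oU Cf; apply: (CkM oU (Ck_cst _ _ (a : R^o)) Cf). Qed.

Lemma Ck_mul_gram c k v l : atlas A c ->
  Ck k (cimg c) (fun x => (v *m gram c x) 0 l : R^o).
Proof.
move=> Ac; have oc := sm_img_open hQ Ac.
rewrite (_ : (fun _ => _) = fun x => \sum_(i < n) v 0 i * gram c x i l : R^o).
  by apply: Ck_sum => // i; apply: Ck_scale => //; apply: gram_smooth.
by apply/funext => x; rewrite mxE.
Qed.

Lemma Ck_tensor_lsubmx m (T : tensor R n Q m) c k al : tensor_field A T -> atlas A c ->
  Ck k (natural_dom c) (fun z => tensor_in_chart A c T al (lsubmx z) : R^o).
Proof.
move=> tT Ac; apply: (@Ck_lsubmx R^o c k (tensor_in_chart A c T al)).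
exact: (tf_smooth tT Ac).
Qed.

(** In the natural chart of [c], the component along [v] of the momentum part of Psi_{T_k}. *)
Definition psi k (T : tensor R n Q k.+1) c z v : R :=
  (k`!%:R)^-1 * tensor_in_chart A c T
    [eta (fun=> rsubmx z) with ord_max |-> v *m gram c (lsubmx z)] (lsubmx z).

Lemma psi_smooth k (T : tensor R n Q k.+1) c v : tensor_field A T -> atlas A c ->
  smooth_on (natural_dom c) (fun z => psi T c z v : R^o).
Proof.
move=> tT Ac r; have od := natural_dom_open Ac; apply: Ck_scale => //.
pose al (i : 'I_k.+1) (z : 'rV[R]_(n + n)) :=
  if i == ord_max then v *m gram c (lsubmx z) else rsubmx z.
apply: (@Ck_multilinear R n 'rV[R]_(n + n) k.+1
  (fun z be => tensor_in_chart A c T be (lsubmx z)) _ (natural_dom c) r al od).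
- by move=> z; apply: tensor_in_chart_multilinear.
- by move=> be; apply: Ck_tensor_lsubmx.
move=> i l; rewrite /al; case: eqP => _; last exact: Ck_rsubmx.
by apply: (@Ck_lsubmx R^o c r (fun x => (v *m gram c x) 0 l)); apply: Ck_mul_gram.
Qed.

Lemma pairing_Psi_comps k (T : tensor R n Q k.+1) q a v : tensor_field A T ->
  pairing (Psi_comps g T q a) v =
  (k`!%:R)^-1 * T q [eta (fun=> a) with ord_max |-> flat g q v].
Proof.
move=> tT; apply: (@pairing_covector_of_fun R n (fun v => (k`!%:R)^-1 *
  T q [eta (fun=> a) with ord_max |-> flat g q v])) => b u w.
by rewrite flat_linear (tf_multilinear tT) mulrDr mulrCA.
Qed.

Lemma pairing_Psi_comps_chart k (T : tensor R n Q k.+1) c z v :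
  tensor_field A T -> atlas A c -> natural_dom c z ->
  pairing (Psi_comps g T (cinv c (lsubmx z)) (cov_of_chart A c (cinv c (lsubmx z)) (rsubmx z)))
    (of_chart A c (cinv c (lsubmx z)) v) = psi T c z v.
Proof.
move=> tT Ac cz; rewrite pairing_Psi_comps // flat_of_chart //.
by congr (_ * T _ _); apply/funext => i /=; case: eqP.
Qed.

Section Sums.
Context {s : nat} {T : forall k : nat, tensor R n Q k.+1}.
Arguments T : clear implicits.
Context (tT : forall k, (k <= s)%N -> tensor_field A (T k)).

Lemma Psi_sum_chart c z : atlas A c -> natural_dom c z ->
  cmap (nat_chart c) (Psi_sum g s T (cinv (nat_chart c) z)) =
  row_mx (lsubmx z) (\row_j \sum_(k < s.+1) psi (T k) c z (delta_mx 0 j)).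
Proof.
move=> Ac cz; rewrite /= (cinvK hQ) //; congr row_mx; apply/rowP => j.
rewrite -pairing_delta pairing_cov_to_chart pairing_suml mxE.
by apply: eq_bigr => k _; apply: pairing_Psi_comps_chart => //; apply: tT; rewrite -ltnS.
Qed.

Lemma Psi_sum_smooth c : atlas A c -> smooth_on (natural_dom c)
  (cmap (nat_chart c) \o Psi_sum g s T \o cinv (nat_chart c)).
Proof.
move=> Ac k; have od := natural_dom_open Ac.
apply: (@Ck_ext _ _ _ _ _ (fun z => row_mx (lsubmx z)
    (\row_j \sum_(k < s.+1) psi (T k) c z (delta_mx 0 j)))) => //.
  by move=> z cz; rewrite -Psi_sum_chart.
apply: Ck_rV => // j; case: (split_ordP j) => i ->.
  rewrite (_ : (fun _ => _) = fun z : 'rV[R]_(n + n) => z 0 (lshift n i)); last first.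
    by apply/funext => z; rewrite row_mxEl mxE.
  apply: (@Ck_coord R 'rV[R]_(n + n) 1 (n + n) _ k (fun z => z)) => //.
  exact: (@Ck_linear R (n + n) 'rV[R]_(n + n) idfun).
rewrite (_ : (fun _ => _) = fun z => \sum_(k < s.+1) psi (T k) c z (delta_mx 0 i)).
  by apply: Ck_sum => // l; apply: psi_smooth => //; apply: tT; rewrite -ltnS.
by apply/funext => z; rewrite row_mxEr mxE.
Qed.

(* [Psi (al) (sharp al) - S (al)], where [S (al) = sum_k T_k (al, .., al) / (k+1)!]
   has the fibre derivative [sharp (Psi (al))] by the symmetry of the [T_k]. *)
Definition fibre_defect (m : @cotangent R n Q) : R :=
  \sum_(k < s.+1) k%:R / (k.+1)`!%:R * T k (foot m) (fun=> comps m).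

Lemma fibre_defect_smooth c : atlas A c ->
  smooth_on (natural_dom c) (fibre_defect \o cinv (nat_chart c) : _ -> R^o).
Proof.
move=> Ac r; have od := natural_dom_open Ac.
apply: Ck_sum => // k; apply: Ck_scale => //.
have tk : tensor_field A (T k) by apply: tT; rewrite -ltnS.
apply: (@Ck_multilinear R n 'rV[R]_(n + n) k.+1
  (fun z be => tensor_in_chart A c (T k) be (lsubmx z)) _ (natural_dom c) r
  (fun _ z => rsubmx z) od).
- by move=> z; apply: tensor_in_chart_multilinear.
- by move=> be; apply: Ck_tensor_lsubmx.
by move=> i l; apply: Ck_rsubmx.
Qed.

End Sums.

End LocalRepresentation.

Arguments gram {R n Q} A g c x.
Arguments psi {R n Q} A g {k} T c z v.
Arguments fibre_defect {R n Q} s T m.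

(** * The Levi-Civita connection *)

Section LeviCivita.
Context {R : realType} {n : nat} {Q : topologicalType} {A : @charted R n Q}.
Context (hQ : smooth_manifold A) {g : Q -> 'M[R]_n} (hg : semi_riemannian A g).
Context {nabla : Q -> 'rV[R]_n -> (Q -> 'rV[R]_n) -> 'rV[R]_n}.
Context (hnabla : levi_civita A g nabla).
Context (q : Q).
Implicit Types (u v w a p b : 'rV[R]_n).
Local Notation c := (chart_at A q).
Local Notation x0 := (cmap (chart_at A q) q).

Let Ac : atlas A c := chart_at_atlas hQ q.
Let cx0 : cimg c x0 := cimg_cmap (chart_at_dom hQ q).

Lemma coord_vf_in_chart j x : cimg c x ->
  vf_in_chart A c (coord_vf A c j) x = delta_mx 0 j.
Proof. by move=> cx; apply: (of_chartK hQ) => //; apply: (cinv_dom hQ). Qed.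

Lemma coord_vf_centre j : coord_vf A c j q = delta_mx 0 j.
Proof. exact: (of_chart_centre hQ). Qed.

Lemma coord_vf_smooth_near j : vf_smooth_near A q (coord_vf A c j).
Proof.
exists (cimg c); split=> //; first exact: (sm_img_open hQ).
move=> k; apply: (@Ck_ext _ _ _ _ _ (cst (delta_mx 0 j))).
- exact: (sm_img_open hQ).
- by move=> x cx; rewrite coord_vf_in_chart.
- exact: Ck_cst.
Qed.

(** In the row-vector convention, [w *m christoffel v] is the covariant derivative along [v], at
    [q], of the field with constant components [w] in the chart [c]. *)
Definition christoffel v : 'M[R]_n := \matrix_(j < n) nabla q v (coord_vf A c j).

Lemma row_christoffel v j : row j (christoffel v) = nabla q v (coord_vf A c j).
Proof. exact: rowK. Qed.

Lemma christoffelP (k : R) u v :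
  christoffel (k *: u + v) = k *: christoffel u + christoffel v.
Proof.
apply/row_matrixP => j; rewrite linearP /= !row_christoffel.
by rewrite (nabla_lin (lc_connection hnabla)) //; apply: coord_vf_smooth_near.
Qed.

Lemma christoffel_sum v : christoffel v = \sum_(i < n) v 0 i *: christoffel (delta_mx 0 i).
Proof.
pose lL := GRing.isLinear.Build _ _ _ _ (christoffel : _ -> 'M[R]_n) christoffelP.
pose L : {linear 'rV[R]_n -> 'M[R]_n} := HB.pack (christoffel : 'rV[R]_n -> 'M[R]_n) lL.
rewrite [LHS](_ : _ = L v) // {1}(row_sum_delta v) linear_sum.
by apply: eq_bigr => i _; rewrite linearZ.
Qed.

(** Coordinate fields have constant components, hence vanishing brackets, so torsion-freeness gives
    the symmetry on basis vectors; bilinearity does the rest. *)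
Lemma christoffel_sym v w : w *m christoffel v = v *m christoffel w.
Proof.
have S i j : row i (christoffel (delta_mx 0 j)) = row j (christoffel (delta_mx 0 i)).
  rewrite !row_christoffel; apply/eqP; rewrite -subr_eq0.
  have := lc_torsion_free hnabla (coord_vf_smooth_near j) (coord_vf_smooth_near i).
  rewrite !coord_vf_centre => ->; rewrite /lie_bracket.
  have D u k : 'D_u (vf_in_chart A c (coord_vf A c k)) x0 = 0.
    rewrite -(derive_cst (delta_mx 0 k : 'rV[R]_n) x0 u); apply: near_eq_derive.
    apply: filterS (near_cimg hQ Ac cx0) => x cx; exact: coord_vf_in_chart.
  by rewrite !D subrr.
rewrite (christoffel_sum v) (christoffel_sum w) !mulmx_sumr.
rewrite {1}(row_sum_delta w) [in RHS](row_sum_delta v).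
under eq_bigr => i _ do rewrite mulmx_suml.
under [RHS]eq_bigr => i _ do rewrite mulmx_suml.
rewrite exchange_big; apply: eq_bigr => i _; apply: eq_bigr => j _.
by rewrite -!scalemxAr -!scalemxAl !scalerA mulrC -!rowE S.
Qed.

Lemma gform_sym u v : gform (g q) u v = gform (g q) v u.
Proof.
rewrite /gform; have -> : u *m g q *m v^T = (v *m g q *m u^T)^T.
  by rewrite !trmx_mul trmxK (sr_sym hg) mulmxA.
by rewrite mxE.
Qed.

Definition dgram v : 'M[R]_n :=
  \matrix_(i, j) 'D_v (fun x => gram A g c x i j : R^o) x0.

Lemma is_derive_gram v : is_derive x0 v (gram A g c) (dgram v).
Proof.
apply: is_derive_mx => i j; rewrite mxE; apply: derivableP; apply: diff_derivable.
by have [+ _] := gram_smooth hg i j Ac 1; apply.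
Qed.

(** Metric compatibility, applied to pairs of coordinate fields. *)
Lemma dgram_christoffel v :
  dgram v = christoffel v *m g q + (christoffel v *m g q)^T.
Proof.
apply/matrixP => i j; rewrite mxE [RHS]mxE.
have dg : differentiable (fun x => gram A g c x i j : R^o) x0.
  by have [+ _] := gram_smooth hg i j Ac 1; apply.
have := lc_metric hnabla v (coord_vf_smooth_near i) (coord_vf_smooth_near j).
rewrite !coord_vf_centre -!row_christoffel /d0.
rewrite (_ : _ \o _ = fun x => gram A g c x i j); last first.
  by apply/funext => x; rewrite mxE.
rewrite -deriveE // => ->; congr (_ + _).
  by rewrite gform_pairing pairing_delta -row_mul [LHS]mxE.
by rewrite gform_sym gform_pairing pairing_delta -row_mul [LHS]mxE [RHS]mxE.
Qed.

Lemma nabla_covE v a : nabla_cov A nabla q v a = - (a *m (christoffel v)^T).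
Proof.
apply/rowP => j; rewrite !mxE -row_christoffel pairingE; congr (- _).
by apply: eq_bigr => i _; rewrite !mxE.
Qed.

Lemma nabla_cov_linear v (k : R) a b : nabla_cov A nabla q v (k *: a + b) =
  k *: nabla_cov A nabla q v a + nabla_cov A nabla q v b.
Proof. by rewrite !nabla_covE mulmxDl -scalemxAl opprD scalerN. Qed.

Lemma nabla_cov_linear_dir (k : R) u v a : nabla_cov A nabla q (k *: u + v) a =
  k *: nabla_cov A nabla q u a + nabla_cov A nabla q v a.
Proof.
rewrite !nabla_covE christoffelP linearP /= mulmxDr -scalemxAr opprD.
by rewrite scalerN.
Qed.

Section NablaTensor.
Context {m : nat} (T : tensor R n Q m) (tT : tensor_field A T) (sT : tensor_symmetric T).
Implicit Types (al : 'I_m -> 'rV[R]_n).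
Local Notation D v al := ('D_v (tensor_in_chart A c T al : 'rV[R]_n -> R^o) x0).

Lemma tensor_in_chart_differentiable al :
  differentiable (tensor_in_chart A c T al : _ -> R^o) x0.
Proof. by have [+ _] := tf_smooth tT Ac al 1; apply. Qed.

Lemma derive_tensor_multilinear v : multilinear (fun al => D v al).
Proof.
move=> al i k b b'.
rewrite (_ : tensor_in_chart A c T _ =
  (k \*: (tensor_in_chart A c T [eta al with i |-> b] : _ -> R^o)) \+
  (tensor_in_chart A c T [eta al with i |-> b'] : _ -> R^o)).
  have d1 := @diff_derivable _ _ _ _ _ v (tensor_in_chart_differentiable [eta al with i |-> b]).
  have d2 := @diff_derivable _ _ _ _ _ v (tensor_in_chart_differentiable [eta al with i |-> b']).
  by rewrite (deriveD (derivableZ (k:=k) d1) d2) (deriveZ k d1).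
by apply/funext => x; exact: (tensor_in_chart_multilinear tT).
Qed.

Lemma derive_tensor_linear_dir (k : R) u v al : D (k *: u + v) al = k * D u al + D v al.
Proof.
have E w : D w al = 'd (tensor_in_chart A c T al : _ -> R^o) x0 w.
  exact: deriveE (tensor_in_chart_differentiable al).
by rewrite !E linearP.
Qed.

Lemma nabla_tensor_linear_dir (k : R) u v al :
  nabla_tensor A nabla T q (k *: u + v) al =
  k * nabla_tensor A nabla T q u al + nabla_tensor A nabla T q v al.
Proof.
rewrite /nabla_tensor derive_tensor_linear_dir mulrBr addrACA; congr (_ + _).
rewrite mulr_sumr -opprD -big_split /=; congr (- _); apply: eq_bigr => r _.
by rewrite nabla_cov_linear_dir (tf_multilinear tT).
Qed.

Lemma nabla_tensor_multilinear v : multilinear (nabla_tensor A nabla T q v).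
Proof.
move=> al i k b b'; rewrite /nabla_tensor derive_tensor_multilinear mulrBr addrACA.
congr (_ + _); rewrite mulr_sumr -opprD -big_split /=; congr (- _).
apply: eq_bigr => r _; case: (eqVneq r i) => [->|ri].
  by rewrite !with_same nabla_cov_linear (tf_multilinear tT).
have ir : i != r by rewrite eq_sym.
by rewrite !(with_comm al _ _ ir) (tf_multilinear tT).
Qed.

Lemma nabla_tensor_symmetric v : slot_symmetric (nabla_tensor A nabla T q v).
Proof.
move=> al s.
have E : tensor_in_chart A c T (al \o s) = tensor_in_chart A c T al.
  by apply/funext => x; rewrite /tensor_in_chart -[RHS](sT _ _ s).
rewrite /nabla_tensor E; congr (_ - _).
rewrite [RHS](reindex_inj (@perm_inj _ s)) /=; apply: eq_bigr => r _.
by rewrite -with_perm sT.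
Qed.

End NablaTensor.
End LeviCivita.

Arguments christoffel {R n Q} A nabla q v.
Arguments dgram {R n Q} A g q v.

(** * Multilinearity and symmetry of R_T in its last slots *)

Section RTAlgebra.
Context {R : realType} {n : nat} {Q : topologicalType} {A : @charted R n Q}.
Context (hQ : smooth_manifold A) {g : Q -> 'M[R]_n} (hg : semi_riemannian A g).
Context {nabla : Q -> 'rV[R]_n -> (Q -> 'rV[R]_n) -> 'rV[R]_n}.
Context (hnabla : levi_civita A g nabla) (q : Q).
Context {k : nat} {T : tensor R n Q k.+1}.
Context (tT : tensor_field A T) (sT : tensor_symmetric T).
Implicit Types (p b : 'rV[R]_n) (tl : 'I_k.+1 -> 'rV[R]_n).
Local Notation N := (nabla_tensor A nabla T q).

Lemma sharp_linear (a : R) p b : sharp g q (a *: p + b) = a *: sharp g q p + sharp g q b.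
Proof. by rewrite /sharp mulmxDl -scalemxAl. Qed.

Lemma RT_cons b tl : RT A g nabla T q (cov_cons b tl) =
  \sum_(i < k.+1) N (sharp g q (tl i)) [eta tl with i |-> b] - N (sharp g q b) tl.
Proof.
rewrite /RT cov_cons0.
have -> : (fun i : 'I_k.+1 => cov_cons b tl (lift ord0 i)) = tl.
  by apply/funext => i; rewrite cov_consS.
by congr (_ - _); apply: eq_bigr => i _; rewrite cov_consS.
Qed.

(** The first slot of R_T is distinguished and stays fixed: polarization will be applied to the
    other slots, among which R_T is symmetric. *)
Lemma RT_cons_multilinear b : multilinear (fun tl => RT A g nabla T q (cov_cons b tl)).
Proof.
move=> tl j a v v'; rewrite !RT_cons mulrBr addrACA -opprD.
rewrite -(nabla_tensor_multilinear hQ q tT); congr (_ - _).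
rewrite mulr_sumr -big_split /=; apply: eq_bigr => i _.
(* In the summand [i = j] the covector of slot [j] occurs only as the direction of differentiation;
   in the others it is an argument of the differentiated tensor. *)
case: (eqVneq i j) => [->|ij].
  by rewrite !with_same sharp_linear (nabla_tensor_linear_dir hQ hnabla q tT).
have ji : j != i by rewrite eq_sym.
by rewrite !(with_comm tl _ _ ji) (nabla_tensor_multilinear hQ q tT).
Qed.

Lemma RT_cons_symmetric b : slot_symmetric (fun tl => RT A g nabla T q (cov_cons b tl)).
Proof.
move=> tl s; rewrite !RT_cons (nabla_tensor_symmetric q sT); congr (_ - _).
rewrite [RHS](reindex_inj (@perm_inj _ s)) /=; apply: eq_bigr => i _.
by rewrite -with_perm (nabla_tensor_symmetric q sT).
Qed.

(** The [k.+1] summands agree by symmetry of the covariant derivative; the factor [k.+1] turns the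
    coefficient 1/(k+1)! of R_T in rho into the 1/k! of Psi_T. *)
Lemma RT_diagonal b p : RT A g nabla T q (cov_cons b (fun=> p)) =
  k.+1%:R * N (sharp g q p) [eta (fun=> p) with ord_max |-> b] -
  N (sharp g q b) (fun=> p).
Proof.
rewrite RT_cons; congr (_ - _).
rewrite (eq_bigr (fun=> N (sharp g q p) [eta (fun=> p) with ord_max |-> b])).
  by rewrite sumr_const card_ord mulr_natl.
by move=> i _; apply: symmetric_with1; apply: (nabla_tensor_symmetric q sT).
Qed.

End RTAlgebra.

(** * The Hamiltonian vector field *)

Section CkInverse.
Context {R : realType} {V : normedModType R}.
Implicit Types (U : set V).

Lemma CkV U k (f : V -> R^o) : open U -> (forall x, U x -> f x != 0) ->
  Ck k U f -> Ck k U (fun x => (f x)^-1 : R^o).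
Proof.
move=> oU f0; elim: k => [|k ih].
  by move=> cf x Ux; apply: cvgV; [exact: f0|exact: (cf x Ux)].
move=> Cf; have [df Df] := Cf; have IH := ih (CkS Cf); split=> [x Ux|v].
  by apply: differentiableV; [exact: df|exact: f0].
apply: (@Ck_ext _ _ _ _ _ (fun x => (-1) * ((f x)^-1 * ((f x)^-1 * 'D_v f x)) : R^o)) => //.
  move=> x Ux; rewrite (deriveV (f0 x Ux) (@diff_derivable _ _ _ _ _ v (df x Ux))).
  by rewrite mulN1r scaleNr -[_ *: _]/(_ * _) expr2 invfM mulrA.
apply: (CkM oU (Ck_cst _ _ (-1 : R^o))); apply: (CkM oU IH).
exact: (CkM oU IH (Df v)).
Qed.

Lemma Ck_det U k m (M : V -> 'M[R]_m) : open U ->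
  (forall i j, Ck k U (fun x => M x i j : R^o)) -> Ck k U (fun x => \det (M x) : R^o).
Proof.
move=> oU CM; rewrite /determinant; apply: Ck_sum => // s.
apply: (CkM oU (Ck_cst _ _ ((-1) ^+ s : R^o))).
by apply: Ck_prod.
Qed.

(** Cramer's rule: each entry is a cofactor divided by the determinant. *)
Lemma Ck_invmx U k m (M : V -> 'M[R]_m) : open U -> (forall x, U x -> M x \in unitmx) ->
  (forall i j, Ck k U (fun x => M x i j : R^o)) ->
  forall i j, Ck k U (fun x => invmx (M x) i j : R^o).
Proof.
move=> oU uM CM i j.
apply: (@Ck_ext _ _ _ _ _ (fun x => (\det (M x))^-1 *
   ((-1) ^+ (j + i) * \det (row' j (col' i (M x)))) : R^o)) => //.
  by move=> x Ux; rewrite /invmx uM // !mxE.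
apply: CkM => //.
  apply: CkV => //; last exact: Ck_det.
  by move=> x /uM; rewrite unitmxE unitfE.
apply: (CkM oU (Ck_cst _ _ ((-1) ^+ (j + i) : R^o))); apply: Ck_det => // a b.
rewrite (_ : (fun _ => _) = fun x => M x (lift j a) (lift i b)) //.
by apply/funext => x; rewrite !mxE.
Qed.

End CkInverse.

Section Hamiltonian.
Context {R : realType} {n : nat} {Q : topologicalType} {A : @charted R n Q}.
Context (hQ : smooth_manifold A) {g : Q -> 'M[R]_n} (hg : semi_riemannian A g).
Context {V : Q -> R} (sV : smooth_fun A V).
Implicit Types (c : @chart R n Q) (q : Q) (x u v a p : 'rV[R]_n) (z w : 'rV[R]_(n + n)).
Local Notation gram := (gram A g).

(** A vector killed by the Gram matrix has zero image under the musical map [flat], which [sharp]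
    inverts. *)
Lemma gram_unit c x : atlas A c -> cimg c x -> gram c x \in unitmx.
Proof.
move=> Ac cx; rewrite -row_free_unit; apply: inj_row_free => v v0.
have cq := cinv_dom hQ Ac cx.
rewrite -(of_chartK hQ v Ac cq) -(flatK hg (cinv c x) (of_chart _ _ _ v)).
rewrite (flat_of_chart hQ) // v0.
have -> : cov_of_chart A c (cinv c x) 0 = 0.
  by apply: pairing_inj => u; rewrite pairing_cov_of_chart !pairing0l.
by rewrite /sharp mul0mx /to_chart linear0.
Qed.

Lemma sharp_cov_of_chart c x p : atlas A c -> cimg c x ->
  sharp g (cinv c x) (cov_of_chart A c (cinv c x) p) =
  of_chart A c (cinv c x) (p *m invmx (gram c x)).
Proof.
move=> Ac cx; rewrite -[RHS](flatK hg (cinv c x)) (flat_of_chart hQ) //.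
by rewrite mulmxKV // gram_unit.
Qed.

(** The value g^*(p, p) in coordinates, that is, twice the kinetic energy. *)
Definition kinetic_chart c z : R :=
  \sum_(i < n) \sum_(j < n)
    rsubmx z 0 i * (invmx (gram c (lsubmx z)) i j * rsubmx z 0 j).

Lemma mechanical_chart c z : atlas A c -> natural_dom c z ->
  mechanical g V (cinv (natural_chart A c) z) =
  2^-1 * kinetic_chart c z + V (cinv c (lsubmx z)).
Proof.
move=> Ac cz; rewrite /mechanical /=; congr (_ * _ + _).
rewrite /dual_metric gform_pairing -[_ *m g _]/(flat g _ _) (sharpK hg).
rewrite sharp_cov_of_chart // pairing_cov_of_chart (of_chartK hQ) //; last exact: (cinv_dom hQ).
by rewrite pairingC /kinetic_chart pairing_mulmx.
Qed.

Lemma kinetic_chart_smooth c : atlas A c ->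
  smooth_on (natural_dom c) (kinetic_chart c : _ -> R^o).
Proof.
move=> Ac k; have od := natural_dom_open hQ Ac.
apply: Ck_sum => // i; apply: Ck_sum => // j.
apply: CkM => //; first exact: Ck_rsubmx.
apply: CkM => //; last exact: Ck_rsubmx.
apply: (@Ck_lsubmx R n Q R^o c k (fun x => invmx (gram c x) i j)).
apply: Ck_invmx.
- exact: (sm_img_open hQ).
- by move=> x cx; apply: gram_unit.
- by move=> i' j'; apply: (gram_smooth hg).
Qed.

End Hamiltonian.

Arguments kinetic_chart {R n Q} A g c z.

Lemma is_derive_comp_lsubmx {R : realType} (n : nat) (W : normedModType R)
    (f : 'rV[R]_n -> W) (z w : 'rV[R]_(n + n)) df :
  is_derive (lsubmx z) (lsubmx w) f df -> is_derive z w (fun z => f (lsubmx z)) df.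
Proof. exact: (@is_derive_comp_linear R _ _ _ lsubmx). Qed.

Lemma is_derive_rsubmx {R : realType} (n : nat) (z w : 'rV[R]_(n + n)) :
  is_derive z w (rsubmx : _ -> 'rV[R]_n) (rsubmx w).
Proof. exact: (is_derive_linear rsubmx). Qed.

Lemma omegaE {R : realType} n (Q : Type) (m : @cotangent R n Q) u v :
  omega m u v = pairing (lsubmx u) (rsubmx v) - pairing (lsubmx v) (rsubmx u).
Proof. by rewrite /omega sumrB !pairingE. Qed.

Section HamiltonianField.
Context {R : realType} {n : nat} {Q : topologicalType} {A : @charted R n Q}.
Context (hQ : smooth_manifold A) {g : Q -> 'M[R]_n} (hg : semi_riemannian A g).
Context {V : Q -> R} (sV : smooth_fun A V).
Context (q : Q) (p : 'rV[R]_n).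
Implicit Types (u v a : 'rV[R]_n) (z w : 'rV[R]_(n + n)).
Local Notation c := (chart_at A q).
Local Notation x0 := (cmap (chart_at A q) q).
Local Notation z0 := (row_mx (cmap (chart_at A q) q) p).
Local Notation gram := (gram A g).
Local Notation dG := (dgram A g q).
Local Notation y := (sharp g q p).

Let Ac : atlas A c := chart_at_atlas hQ q.
Let cx0 : cimg c x0 := cimg_cmap (chart_at_dom hQ q).

Lemma natural_dom_centre : natural_dom c z0.
Proof. by rewrite /natural_dom /= row_mxKl. Qed.

Lemma natural_chart_centre : cmap (natural_chart A c) (Covector q p) = z0.
Proof. by rewrite /= (cov_to_chart_centre hQ). Qed.

Lemma near_natural_dom : \forall z \near z0, natural_dom c z.
Proof.
apply: open_nbhs_nbhs; split; first exact: (natural_dom_open hQ Ac).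
exact: natural_dom_centre.
Qed.

Lemma is_derive_inv_gram v i j :
  is_derive x0 v (fun x => invmx (gram c x) i j : R^o)
    (- (invmx (g q) *m dG v *m invmx (g q)) i j).
Proof.
have uG := sr_nondegenerate hg q.
pose N : 'M[R]_n := \matrix_(i, j) 'D_v (fun x => invmx (gram c x) i j : R^o) x0.
have dN i' j' : is_derive x0 v (fun x => invmx (gram c x) i' j' : R^o) (N i' j').
  rewrite mxE; apply: derivableP; apply: diff_derivable.
  have uc x : cimg c x -> gram c x \in unitmx by apply: (gram_unit hQ hg).
  have [+ _] := Ck_invmx (sm_img_open hQ Ac) uc
    (fun i1 i2 => gram_smooth hg i1 i2 Ac 1) i' j'.
  by apply.
(* Once the inverse Gram matrix is known to be differentiable, its derivative is found by
   differentiating G^{-1} G = 1 entry by entry. *)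
have E : invmx (g q) *m dG v + N *m g q = 0.
  apply/matrixP => i' j'; rewrite [RHS]mxE.
  have d := is_derive_bigsum (index_enum 'I_n) (fun k =>
     is_derive_mul (dN i' k) (is_derive_coord k j' (is_derive_gram hQ hg q v))).
  have e : \forall x \near x0,
      (fun x => \sum_(k < n) invmx (gram c x) i' k * gram c x k j') x =
      cst ((1%:M : 'M[R]_n) i' j' : R^o) x.
    apply: filterS (near_cimg hQ Ac cx0) => x cx.
    by rewrite /cst -(mulVmx (gram_unit hQ hg Ac cx)) mxE.
  have [_ Dz] := near_eq_is_derive e d.
  rewrite derive_cst in Dz; rewrite Dz !mxE -big_split /=; apply: eq_bigr => k _.
  by rewrite (gram_centre hQ) [X in _ + X]mulrC.
have -> : - (invmx (g q) *m dG v *m invmx (g q)) i j = N i j.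
  have /(congr1 (fun M => M *m invmx (g q))) := E.
  rewrite mulmxDl mul0mx mulmxK // => /(congr1 (fun M : 'M[R]_n => M i j)).
  by rewrite !mxE => /eqP; rewrite addr_eq0 => /eqP ->; rewrite opprK.
exact: dN.
Qed.

Lemma pairing_invmx_sym u v : pairing (u *m invmx (g q)) v = pairing (v *m invmx (g q)) u.
Proof.
rewrite /pairing.
have -> : u *m invmx (g q) *m v^T = (v *m invmx (g q) *m u^T)^T.
  by rewrite !trmx_mul trmxK trmx_inv (sr_sym hg) mulmxA.
by rewrite mxE.
Qed.

Lemma is_derive_kinetic_chart w : is_derive z0 w (kinetic_chart A g c : _ -> R^o)
  (2 * pairing y (rsubmx w) - gform (dG (lsubmx w)) y y).
Proof.
have dr i := is_derive_coord 0 i (is_derive_rsubmx z0 w).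
have dN i j : is_derive z0 w (fun z => invmx (gram c (lsubmx z)) i j : R^o)
    (- (invmx (g q) *m dG (lsubmx w) *m invmx (g q)) i j).
  apply: (@is_derive_comp_lsubmx R n R^o (fun x => invmx (gram c x) i j)).
  by rewrite row_mxKl; apply: is_derive_inv_gram.
have d := is_derive_bigsum (index_enum 'I_n) (fun i => is_derive_bigsum (index_enum 'I_n)
  (fun j => is_derive_mul (dr i) (is_derive_mul (dN i j) (dr j)))).
apply: (is_derive_eq d).
rewrite row_mxKl row_mxKr (gram_centre hQ).
transitivity (pairing (p *m invmx (g q)) (rsubmx w) +
   pairing (p *m - (invmx (g q) *m dG (lsubmx w) *m invmx (g q))) p +
   pairing (rsubmx w *m invmx (g q)) p).
  rewrite -!pairing_mulmx -!big_split /=; apply: eq_bigr => i _.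
  rewrite -!big_split /=; apply: eq_bigr => j _.
  rewrite mulrDr; congr (_ + _ + _); last by rewrite mulrC.
  by congr (_ * _); rewrite mulrC; congr (_ * _); rewrite [RHS]mxE.
rewrite (pairing_invmx_sym (rsubmx w)) addrAC -mulr2n -[in LHS]mulr_natl; congr (_ + _).
rewrite mulmxN pairingNl; congr (- _).
by rewrite !mulmxA (pairing_invmx_sym _ p) pairingC.
Qed.

Lemma dchart_centre : dchart V c x0 = d_cov A V q.
Proof. by []. Qed.

Lemma diff_mechanical w :
  d0 (cotangent_charted A) (mechanical g V) (Covector q p) w =
  pairing y (rsubmx w) - 2^-1 * gform (dG (lsubmx w)) y y +
  pairing (d_cov A V q) (lsubmx w).
Proof.
rewrite /d0 /= -[row_mx _ _]/(cmap (natural_chart A c) (Covector q p)) natural_chart_centre.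
have dk : differentiable (kinetic_chart A g c : _ -> R^o) z0.
  by have [+ _] := kinetic_chart_smooth hQ hg Ac 1; apply; apply: natural_dom_centre.
have dV : differentiable (fun z : 'rV[R]_(n + n) => V (cinv c (lsubmx z)) : R^o) z0.
  apply: (@differentiable_comp R 'rV[R]_(n + n) 'rV[R]_n R^o lsubmx (V \o cinv c)).
    exact: differentiable_lsubmx.
  by rewrite row_mxKl; have [+ _] := sV Ac 1; apply.
pose F := (fun z => 2^-1 * kinetic_chart A g c z : R^o) \+
  (fun z => V (cinv c (lsubmx z)) : R^o).
have dF : differentiable F z0.
  by apply: differentiableD => //; apply: (@differentiableZ R _ R^o).
have e : \forall z \near z0, F z = mechanical g V (cinv (natural_chart A c) z).
  by apply: filterS near_natural_dom => z cz; rewrite (mechanical_chart hQ hg).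
have E := congr1 (fun f => f w) (near_eq_diff e dF).
apply: (etrans E); apply: diff_is_derive => //.
have d1 := is_derive_mull 2^-1 (is_derive_kinetic_chart w).
have d2 : is_derive z0 w (fun z : 'rV[R]_(n + n) => V (cinv c (lsubmx z)) : R^o)
    (pairing (d_cov A V q) (lsubmx w)).
  apply: (@is_derive_comp_lsubmx R n R^o (V \o cinv c)); rewrite row_mxKl.
  rewrite -dchart_centre pairing_dchart; apply: differentiable_is_derive.
  by have [+ _] := sV Ac 1; apply.
apply: (is_derive_eq (is_deriveD d1 d2)); congr (_ + _).
by rewrite mulrBr mulrA mulVf ?mul1r // pnatr_eq0.
Qed.

(** Hamilton's equations: the defining identity of X_H is tested on vertical vectors for the base
    part and on horizontal ones for the momentum part. The term in [dG] has a plus sign because the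
    derivative of G^{-1} already carries a minus. *)
Lemma hamiltonian_field_centre X : is_hamiltonian_vf A (mechanical g V) X ->
  lsubmx (X (Covector q p)) = y /\
  forall v, pairing (rsubmx (X (Covector q p))) v =
    2^-1 * gform (dG v) y y - pairing (d_cov A V q) v.
Proof.
move=> hX; set Xm := X _.
have h w : pairing (lsubmx Xm) (rsubmx w) - pairing (lsubmx w) (rsubmx Xm) =
   pairing y (rsubmx w) - 2^-1 * gform (dG (lsubmx w)) y y +
   pairing (d_cov A V q) (lsubmx w).
  by rewrite -diff_mechanical -hX /interior_product omegaE.
have dG0 : dG 0 = 0 by apply/matrixP => i j; rewrite !mxE derive0.
split.
  apply: pairing_inj => v; have := h (row_mx 0 v); rewrite row_mxKl row_mxKr dG0.
  rewrite /gform mulmx0 mul0mx mxE mulr0 pairing0l !subr0 => ->.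
  by rewrite (pairingC _ 0) pairing0l addr0.
move=> v; have := h (row_mx v 0); rewrite row_mxKl row_mxKr.
rewrite !(pairingC _ 0) !pairing0l !sub0r pairingC => /(congr1 -%R).
by rewrite opprK => ->; rewrite opprD opprK.
Qed.

End HamiltonianField.

(** * The form [i_X Psi^* omega] *)

Section PointwiseFormula.
Context {R : realType} {n : nat} {Q : topologicalType} {A : @charted R n Q}.
Context (hQ : smooth_manifold A) {g : Q -> 'M[R]_n} (hg : semi_riemannian A g).
Context {nabla : Q -> 'rV[R]_n -> (Q -> 'rV[R]_n) -> 'rV[R]_n}.
Context (hnabla : levi_civita A g nabla).
Context {V : Q -> R} (sV : smooth_fun A V).
Context (q : Q) (p : 'rV[R]_n).
Implicit Types (u v a : 'rV[R]_n) (z w : 'rV[R]_(n + n)).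
Local Notation c := (chart_at A q).
Local Notation x0 := (cmap (chart_at A q) q).
Local Notation z0 := (row_mx (cmap (chart_at A q) q) p).
Local Notation gram := (gram A g).
Local Notation dG := (dgram A g q).
Local Notation y := (sharp g q p).
Local Notation Gamma := (christoffel A nabla q).
Local Notation nc := (nabla_cov A nabla q).
Local Notation dV := (d_cov A V q).

Let Ac : atlas A c := chart_at_atlas hQ q.
Let cx0 : cimg c x0 := cimg_cmap (chart_at_dom hQ q).

Lemma is_derive_mulmx_gram v u : is_derive x0 u (fun x => v *m gram c x) (v *m dG u).
Proof.
apply: is_derive_mx => i j; rewrite mxE.
rewrite (_ : (fun _ => _) = fun x => \sum_(l < n) v i l * gram c x l j : R^o); last first.
  by apply/funext => x; rewrite mxE.
apply: is_derive_bigsum => l; apply: is_derive_mull.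
exact: (is_derive_coord l j (is_derive_gram hQ hg q u)).
Qed.

(** Newton's equation: along a trajectory the covariant derivative of the momentum is -dV. The two
    halves of [dG v] agree on (y, y), which absorbs the factor 1/2, and torsion-freeness exchanges
    [v] and [y]. *)
Lemma rsubmx_hamiltonian_field X : is_hamiltonian_vf A (mechanical g V) X ->
  rsubmx (X (Covector q p)) = - nc y p - dV.
Proof.
move=> hX; have [_ hr] := hamiltonian_field_centre hQ hg sV q p hX.
apply: pairing_inj => v; rewrite hr pairingDl pairingNl; congr (_ + _); last first.
  by rewrite pairingNl.
rewrite nabla_covE pairingNl opprK (dgram_christoffel hQ hg hnabla).
rewrite /gform mulmxDr mulmxDl mxE.
have -> : y *m (Gamma v *m g q)^T *m y^T = (y *m (Gamma v *m g q) *m y^T)^T.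
  by rewrite [RHS]trmx_mul (trmx_mul y) trmxK mulmxA.
rewrite [X in _ + X]mxE.
rewrite -mulr2n -[X in 2^-1 * X]mulr_natl mulrA mulVf ?pnatr_eq0 // mul1r.
have Gy : g q *m y^T = p^T.
  by rewrite -[in RHS](sharpK hg q p) /flat (trmx_mul _ (g q)) (sr_sym hg).
rewrite mulmxA (christoffel_sym hQ hnabla) -mulmxA Gy /pairing.
have -> : v *m Gamma y *m p^T = (p *m (Gamma y)^T *m v^T)^T.
  by rewrite [RHS]trmx_mul (trmx_mul p) !trmxK mulmxA.
by rewrite mxE.
Qed.

Section OneTensor.
Context {k : nat} {T : tensor R n Q k.+1}.
Context (tT : tensor_field A T) (sT : tensor_symmetric T).
Local Notation D v al := ('D_v (tensor_in_chart A c T al : 'rV[R]_n -> R^o) x0).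

Definition dpsi w v : R := (k`!%:R)^-1 *
  (D (lsubmx w) [eta (fun=> p) with ord_max |-> v *m g q] +
   T q [eta (fun=> p) with ord_max |-> v *m dG (lsubmx w)] +
   \sum_(r < k.+1 | r != ord_max)
     T q [eta [eta (fun=> p) with ord_max |-> v *m g q] with r |-> rsubmx w]).

Lemma is_derive_tensor_lsubmx w al : is_derive z0 w
  (fun z => tensor_in_chart A c T al (lsubmx z) : R^o) (D (lsubmx w) al).
Proof.
apply: (@is_derive_comp_lsubmx R n R^o (tensor_in_chart A c T al)).
rewrite row_mxKl; apply: derivableP; apply: diff_derivable.
exact: (tensor_in_chart_differentiable hQ).
Qed.

Lemma is_derive_psi w v : is_derive z0 w (fun z => psi A g T c z v : R^o) (dpsi w v).
Proof.
apply: is_derive_mull.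
pose al (i : 'I_k.+1) (z : 'rV[R]_(n + n)) :=
  if i == ord_max then v *m gram c (lsubmx z) else rsubmx z.
pose dal (i : 'I_k.+1) := if i == ord_max then v *m dG (lsubmx w) else rsubmx w.
have dalP i : is_derive z0 w (al i) (dal i).
  rewrite /al /dal; case: eqP => _; last exact: is_derive_rsubmx.
  apply: (@is_derive_comp_lsubmx R n 'rV[R]_n (fun x => v *m gram c x)).
  by rewrite row_mxKl; apply: is_derive_mulmx_gram.
have := is_derive_multilinear (fun z => tensor_in_chart_multilinear tT c (lsubmx z))
  (is_derive_tensor_lsubmx w) dalP.
have al0 : (fun i => al i z0) = [eta (fun=> p) with ord_max |-> v *m g q].
  by apply/funext => i; rewrite /al row_mxKl row_mxKr (gram_centre hQ) /=; case: eqP.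
rewrite al0 row_mxKl => d; apply: (is_derive_eq d).
rewrite -addrA; congr (_ + _); rewrite (bigD1 ord_max) //=; congr (_ + _).
  by rewrite (tensor_in_chart_centre hQ) /dal eqxx with_same.
apply: eq_bigr => r rm.
by rewrite (tensor_in_chart_centre hQ) /dal (negPf rm).
Qed.

Lemma dpsi_linear w : linear (dpsi w : _ -> R^o).
Proof.
move=> a u v; rewrite /dpsi mulmxDl -scalemxAl (derive_tensor_multilinear hQ q tT).
rewrite [X in T q [eta _ with _ |-> X]]mulmxDl -scalemxAl (tf_multilinear tT).
rewrite (eq_bigr (fun r => a * T q [eta [eta (fun=> p) with ord_max |-> u *m g q] with r |-> rsubmx w] +
  T q [eta [eta (fun=> p) with ord_max |-> v *m g q] with r |-> rsubmx w])).
  rewrite big_split /= -mulr_sumr -[a *: _]/(a * _).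
  move: (D _ _) (D _ _) (T q _) (T q _) (\sum_(_ < _ | _) _) (\sum_(_ < _ | _) _).
  move=> *; ring.
by move=> r rm; rewrite !(with_comm _ _ _ (_ : ord_max != r)) 1?eq_sym // (tf_multilinear tT).
Qed.

Lemma is_derive_tensor_diagonal w : is_derive z0 w
  (fun z => tensor_in_chart A c T (fun=> rsubmx z) (lsubmx z) : R^o)
  (D (lsubmx w) (fun=> p) + k.+1%:R * T q [eta (fun=> p) with ord_max |-> rsubmx w]).
Proof.
have := is_derive_multilinear (fun z => tensor_in_chart_multilinear tT c (lsubmx z))
  (is_derive_tensor_lsubmx w) (fun _ : 'I_k.+1 => is_derive_rsubmx z0 w).
rewrite row_mxKl row_mxKr => d; apply: (is_derive_eq d); congr (_ + _).
rewrite (eq_bigr (fun=> T q [eta (fun=> p) with ord_max |-> rsubmx w])).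
  by rewrite sumr_const card_ord mulr_natl.
move=> r _; rewrite (tensor_in_chart_centre hQ).
by apply: symmetric_with1; apply: sT.
Qed.

(** The k-th term of rho. By symmetry the sum consists of k equal terms, which gives the coefficient
    1/(k-1)!; written as a sum it is empty for k = 0, with no special case. *)
Definition residual_term (xi : 'rV[R]_n) : R :=
  ((k.+1)`!%:R)^-1 * RT A g nabla T q (cov_cons (flat g q xi) (fun=> p)) -
  (k`!%:R)^-1 * \sum_(r < k.+1 | r != ord_max)
    T q [eta [eta (fun=> p) with ord_max |-> flat g q xi] with r |-> dV].

Lemma sum_with_other v a :
  \sum_(r < k.+1 | r != ord_max) T q [eta (fun=> a) with r |-> v] =
  k%:R * T q [eta (fun=> a) with ord_max |-> v].
Proof.
rewrite (eq_bigr (fun=> T q [eta (fun=> a) with ord_max |-> v])).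
  rewrite sumr_const mulr_natl; congr (_ *+ _).
  by rewrite cardC1 card_ord.
by move=> r _; apply: symmetric_with1; apply: sT.
Qed.

(* With [D g = Gamma g + (Gamma g)^T] and [Gamma] torsion free, the derivatives
   of [g] and the force [-(1/2) d g^*(p, p)] turn the partial derivatives of [T]
   into the covariant ones of [RT]. *)
Lemma dpsi_residual X w : is_hamiltonian_vf A (mechanical g V) X ->
  dpsi w y - dpsi (X (Covector q p)) (lsubmx w) =
  k%:R / (k.+1)`!%:R *
    (D (lsubmx w) (fun=> p) + k.+1%:R * T q [eta (fun=> p) with ord_max |-> rsubmx w])
  - residual_term (lsubmx w).
Proof.
move=> hX; have [hl _] := hamiltonian_field_centre hQ hg sV q p hX.
have hr := rsubmx_hamiltonian_field hX.
set xi := lsubmx w; have tm := tf_multilinear tT q.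
have yG : y *m g q = p by apply: (sharpK hg).
have ncE v a : a *m (Gamma v)^T = - nc v a by rewrite nabla_covE opprK.
(* [E1] and [E2] share the term [xi *m Gamma y *m g q], which cancels in the difference of the two
   [dpsi]; only corrections by [nabla_cov] remain, and they complete the derivatives of [T] to
   covariant ones. *)
have E1 : y *m dG xi = xi *m Gamma y *m g q - nc xi p.
  rewrite (dgram_christoffel hQ hg hnabla) mulmxDr mulmxA (christoffel_sym hQ hnabla).
  by congr (_ + _); rewrite trmx_mul (sr_sym hg) mulmxA yG ncE.
have E2 : xi *m dG y = xi *m Gamma y *m g q - nc y (xi *m g q).
  rewrite (dgram_christoffel hQ hg hnabla) mulmxDr mulmxA.
  by congr (_ + _); rewrite trmx_mul (sr_sym hg) mulmxA ncE.
have NE : nabla_tensor A nabla T q y [eta (fun=> p) with ord_max |-> xi *m g q] =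
   D y [eta (fun=> p) with ord_max |-> xi *m g q] -
   (T q [eta (fun=> p) with ord_max |-> nc y (xi *m g q)] +
    \sum_(r < k.+1 | r != ord_max)
      T q [eta [eta (fun=> p) with ord_max |-> xi *m g q] with r |-> nc y p]).
  rewrite /nabla_tensor (bigD1 ord_max) //= eqxx with_same; congr (_ - (_ + _)).
  by apply: eq_bigr => r rm; rewrite (negPf rm).
have NE' : nabla_tensor A nabla T q xi (fun=> p) =
   D xi (fun=> p) - k.+1%:R * T q [eta (fun=> p) with ord_max |-> nc xi p].
  rewrite /nabla_tensor; congr (_ - _).
  rewrite (eq_bigr (fun=> T q [eta (fun=> p) with ord_max |-> nc xi p])).
    by rewrite sumr_const card_ord mulr_natl.
  by move=> r _; apply: symmetric_with1; apply: sT.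
have S : \sum_(r < k.+1 | r != ord_max)
     T q [eta [eta (fun=> p) with ord_max |-> xi *m g q] with r |-> - nc y p - dV] =
   - (\sum_(r < k.+1 | r != ord_max)
     T q [eta [eta (fun=> p) with ord_max |-> xi *m g q] with r |-> nc y p]) -
   \sum_(r < k.+1 | r != ord_max)
     T q [eta [eta (fun=> p) with ord_max |-> xi *m g q] with r |-> dV].
  rewrite -sumrN -sumrB; apply: eq_bigr => r _.
  by rewrite (multilinearB tm) (multilinearN tm).
have cp : [eta (fun=> p) with ord_max |-> p] = (fun=> p) :> ('I_k.+1 -> _).
  by apply/funext => i /=; case: eqP.
rewrite /dpsi /residual_term hl hr yG cp sum_with_other -/xi S.
rewrite (RT_diagonal q sT) (flatK hg) -[flat g q xi]/(xi *m g q) NE NE' E1 E2.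
rewrite !(multilinearB tm) factS natrM.
have k0 : (k`!%:R : R) != 0 by rewrite pnatr_eq0 -lt0n fact_gt0.
have k1 : (k.+1%:R : R) != 0 by rewrite pnatr_eq0.
move: (D xi _) (D y _) (T q _) (T q _) (T q _) (T q _) (\sum_(_ < _ | _) _) (\sum_(_ < _ | _) _).
move=> *; rewrite -natr1 in k1 *; field.
by rewrite k0 k1.
Qed.

End OneTensor.
End PointwiseFormula.

Arguments dpsi {R n Q} A g q p {k} T w v.
Arguments residual_term {R n Q} A g nabla V q p {k} T xi.

(** * Decomposition of the form into an exact and a horizontal part *)

Section ChartFormula.
Context {R : realType} {n : nat} {Q : topologicalType} {A : @charted R n Q}.
Context (hQ : smooth_manifold A) {g : Q -> 'M[R]_n} (hg : semi_riemannian A g).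
Context {nabla : Q -> 'rV[R]_n -> (Q -> 'rV[R]_n) -> 'rV[R]_n}.
Context (hnabla : levi_civita A g nabla).
Context {V : Q -> R} (sV : smooth_fun A V).
Context {s : nat} {T : forall k : nat, tensor R n Q k.+1}.
Arguments T : clear implicits.
Context (hT : forall k, (k <= s)%N -> tensor_field A (T k) /\ tensor_symmetric (T k)).
Implicit Types (u v a : 'rV[R]_n) (z w : 'rV[R]_(n + n)).
Local Notation nat_chart c := (natural_chart A c).
Local Notation CA := (cotangent_charted A).
Local Notation defect := (fibre_defect s T).

Let tT k : (k <= s)%N -> tensor_field A (T k).
Proof. by move=> /hT []. Qed.

Let tTo (k : 'I_s.+1) : tensor_field A (T k).
Proof. by apply: tT; rewrite -ltnS. Qed.

Let sTo (k : 'I_s.+1) : tensor_symmetric (T k).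
Proof. by have /hT[] : (k <= s)%N by rewrite -ltnS. Qed.

Definition residual (m : @cotangent R n Q) xi : R :=
  \sum_(k < s.+1) residual_term A g nabla V (foot m) (comps m) (T k) xi.

Section Centre.
Context (q : Q) (p : 'rV[R]_n).
Local Notation c := (chart_at A q).
Local Notation x0 := (cmap (chart_at A q) q).
Local Notation z0 := (row_mx (cmap (chart_at A q) q) p).

Let Ac : atlas A c := chart_at_atlas hQ q.

Lemma tangent_map_Psi_sum w :
  tangent_map CA CA (Psi_sum g s T) (Covector q p) w =
  row_mx (lsubmx w) (covector_of (fun v => \sum_(k < s.+1) dpsi A g q p (T k) w v)).
Proof.
set F' := (F' in tangent_map _ _ F').
rewrite /tangent_map -[X in 'd _ X](_ : cmap (nat_chart c) (Covector q p) = _) //.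
rewrite (natural_chart_centre hQ).
have dP : differentiable (cmap (nat_chart c) \o F' \o cinv (nat_chart c)) z0.
  have [+ _] := Psi_sum_smooth hQ hg tT Ac 1; apply; exact: natural_dom_centre.
apply: diff_is_derive; first exact: dP.
apply: (@near_eq_is_derive _ _ _ (fun z => row_mx (lsubmx z)
    (\row_j \sum_(k < s.+1) psi A g (T k) c z (delta_mx 0 j)))).
  apply: filterS (near_natural_dom hQ q p) => z cz.
  exact: (esym (Psi_sum_chart hQ tT Ac cz)).
apply: is_derive_mx => i0 j; rewrite (ord1 i0); case: (split_ordP j) => i ->.
  rewrite row_mxEl (_ : (fun _ => _) = fun z => lsubmx z 0 i); last first.
    by apply/funext => z; rewrite row_mxEl.
  exact: (is_derive_coord 0 i (is_derive_linear lsubmx z0 w)).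
rewrite row_mxEr mxE (_ : (fun _ => _) =
    fun z => \sum_(k < s.+1) psi A g (T k) c z (delta_mx 0 i)); last first.
  by apply/funext => z; rewrite row_mxEr mxE.
by apply: is_derive_bigsum => k; apply: is_derive_psi.
Qed.

Lemma diff_fibre_defect w : d0 CA defect (Covector q p) w =
  \sum_(k < s.+1) k%:R / (k.+1)`!%:R *
    ('D_(lsubmx w) (tensor_in_chart A c (T k) (fun=> p) : _ -> R^o) x0 +
     k.+1%:R * T k q [eta (fun=> p) with ord_max |-> rsubmx w]).
Proof.
rewrite /d0 -[X in 'd _ X](_ : cmap (nat_chart c) (Covector q p) = _) //.
rewrite (natural_chart_centre hQ).
apply: diff_is_derive.
  have [+ _] := fibre_defect_smooth hQ tT Ac 1; apply; exact: natural_dom_centre.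
apply: is_derive_bigsum => k; apply: is_derive_mull.
exact: is_derive_tensor_diagonal.
Qed.

Lemma interior_product_centre X w : is_hamiltonian_vf A (mechanical g V) X ->
  interior_product X (pullback CA CA (Psi_sum g s T) (omega (n := n))) (Covector q p) w =
  d0 CA defect (Covector q p) w - residual (Covector q p) (lsubmx w).
Proof.
move=> hX; rewrite /interior_product /pullback omegaE !tangent_map_Psi_sum.
have [hl _] := hamiltonian_field_centre hQ hg sV q p hX.
have cl w' v : pairing (covector_of (fun v => \sum_(k < s.+1) dpsi A g q p (T k) w' v)) v
    = \sum_(k < s.+1) dpsi A g q p (T k) w' v.
  apply: (@pairing_covector_of_fun R n (fun v => \sum_(k < s.+1) dpsi A g q p (T k) w' v)).
  move=> b u v'; rewrite scaler_sumr -big_split /=; apply: eq_bigr => k _.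
  exact: (dpsi_linear hQ _ _ (tTo k)).
rewrite !row_mxKl !row_mxKr hl (pairingC (sharp _ _ _)) (pairingC (lsubmx w)) !cl.
rewrite diff_fibre_defect /residual -!sumrB; apply: eq_bigr => k _.
exact: (dpsi_residual hQ hg hnabla sV).
Qed.

End Centre.

(** [d1] differentiates the form in one fixed chart, whereas [interior_product_centre] speaks at
    each point of the preferred chart there. The exact part passes between them by the chain rule;
    the residual depends only on the base components of the vector. *)
Lemma form_in_natural_chart X c z w : is_hamiltonian_vf A (mechanical g V) X ->
  atlas A c -> natural_dom c z ->
  form_in_chart CA (nat_chart c)
    (interior_product X (pullback CA CA (Psi_sum g s T) (omega (n := n)))) z w =
  'd (defect \o cinv (nat_chart c) : _ -> R^o) z w -
  residual (cinv (nat_chart c) z) (of_chart A c (cinv c (lsubmx z)) (lsubmx w)).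
Proof.
move=> hX Ac cz; rewrite /form_in_chart.
set q := cinv c (lsubmx z); set d := chart_at A q.
have Ad : atlas A d := chart_at_atlas hQ q.
have dq : cdom d (cinv c (lsubmx z)) := chart_at_dom hQ q.
have zE : cmap (nat_chart c) (cinv (nat_chart c) z) = z by apply: (natural_cinvK hQ).
have wE : of_chart CA (nat_chart c) (cinv (nat_chart c) z) w =
    'd (cmap (nat_chart d) \o cinv (nat_chart c)) z w.
  by rewrite /of_chart zE.
rewrite wE.
have dm : cdom d (foot (cinv (nat_chart c) z)) := dq.
have dF : differentiable (defect \o cinv (nat_chart d) : _ -> R^o)
    (cmap (nat_chart d) (cinv (nat_chart c) z)).
  have [+ _] := fibre_defect_smooth hQ tT Ad 1; apply.
  by rewrite /natural_dom /= row_mxKl; apply: cimg_cmap.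
have [_ /(congr1 (fun f => f w)) E] := diff_chart_change (natural_near_cancel hQ Ac Ad cz dq)
  (natural_transition_differentiable hQ Ac Ad cz dq) dF.
apply: (etrans (interior_product_centre q _ _ hX)); congr (_ - _).
  exact: (esym E).
congr (residual _ _); rewrite (lsubmx_natural_transition hQ _ Ac Ad cz dq).
by rewrite /of_chart (cinvK hQ Ac cz).
Qed.

End ChartFormula.

Arguments residual {R n Q} A g nabla V s T m xi.

(** * Dependence on the momentum *)

Section PolynomialIdentities.
Context {R : realType}.

(** Were the polynomial nonzero, the natural numbers below its size would be pairwise distinct
    roots, one more than its degree allows. *)
Lemma polynomial_identity m (a : nat -> R) :
  (forall t : R, \sum_(k < m) a k * t ^+ k = 0) -> forall k, (k < m)%N -> a k = 0.
Proof.
move=> h k km; pose P := \poly_(i < m) a i.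
suff P0 : P = 0 by have := coef_poly m a k; rewrite km -/P P0 coef0.
apply/eqP/negPn/negP => Pn0.
have rP : all (root P) [seq i%:R | i <- iota 0 (size P)].
  by apply/allP => t _; rewrite /root horner_poly h.
have uP : uniq [seq i%:R : R | i <- iota 0 (size P)].
  by rewrite map_inj_uniq ?iota_uniq //; apply: mulrIn; apply: oner_neq0.
by have := max_poly_roots Pn0 rP uP; rewrite size_map size_iota ltnn.
Qed.

Lemma multilinear_homogeneous n m (t : ('I_m -> 'rV[R]_n) -> R) (a : R) p :
  multilinear t -> t (fun=> a *: p) = a ^+ m * t (fun=> p).
Proof.
elim: m t => [|m ih] t tlin.
  by rewrite expr0 mul1r; congr t; apply/funext => -[].
rewrite -cov_cons_const (ih _ (multilinear_cons _ tlin)).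
rewrite -(with_ord0 p) (multilinearZ tlin) with_ord0 cov_cons_const.
by rewrite mulrA -exprSr.
Qed.

End PolynomialIdentities.

Section Residual.
Context {R : realType} {n : nat} {Q : topologicalType} {A : @charted R n Q}.
Context (hQ : smooth_manifold A) {g : Q -> 'M[R]_n} (hg : semi_riemannian A g).
Context {nabla : Q -> 'rV[R]_n -> (Q -> 'rV[R]_n) -> 'rV[R]_n}.
Context (hnabla : levi_civita A g nabla).
Context {V : Q -> R} (sV : smooth_fun A V).
Context {s : nat} {T : forall k : nat, tensor R n Q k.+1}.
Arguments T : clear implicits.
Context (hT : forall k, (k <= s)%N -> tensor_field A (T k) /\ tensor_symmetric (T k)).
Implicit Types (u v a : 'rV[R]_n) (z w : 'rV[R]_(n + n)) (c : @chart R n Q).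
Local Notation nat_chart c := (natural_chart A c).
Local Notation CA := (cotangent_charted A).
Local Notation dV := (d_cov A V).
Local Notation residual := (residual A g nabla V s T).

(** Conditions (i) and (ii) together say that the excess vanishes for all [k <= s]. The family [T]
    is indexed by all of nat, so the test on [k.+2] makes tensors beyond [s] count as zero. *)
Definition excess k q (al : 'I_k.+2 -> 'rV[R]_n) : R :=
  RT A g nabla (T k) q al -
  (if (k.+2 <= s)%N then contract_first dV (T k.+2) q al else 0).

Arguments excess : clear implicits.

Definition potential_form q xi : R :=
  if (1 <= s)%N then contract_first dV (T 1) q (fun=> flat g q xi) else 0.

Lemma excess_multilinear k q b : (k <= s)%N ->
  multilinear (fun tl => excess k q (cov_cons b tl) : R) .
Proof.
move=> /hT[tk _] tl i e v v'.
rewrite /excess (RT_cons_multilinear hQ hnabla q tk).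
case: ifP => [ks|_]; last by rewrite !subr0.
have [tk2 _] := hT ks.
have E := multilinear_cons b (multilinear_cons (dV q) (tf_multilinear tk2 q)) tl i e v v'.
by rewrite /contract_first E; ring.
Qed.

Lemma excess_symmetric k q b : (k <= s)%N ->
  slot_symmetric (fun tl : 'I_k.+1 -> _ => excess k q (cov_cons b tl)).
Proof.
move=> /hT[_ sk] tl e.
rewrite /excess (RT_cons_symmetric q sk); congr (_ - _).
case: ifP => [ks|//]; have [_ sk2] := hT ks.
exact: (symmetric_cons b (symmetric_cons (dV q) (sk2 q))).
Qed.

Lemma sum_two_slots k q p b : (k.+1 <= s)%N ->
  \sum_(r < k.+2 | r != ord_max)
    T k.+1 q [eta [eta (fun=> p) with ord_max |-> b] with r |-> dV q] =
  k.+1%:R * contract_first dV (T k.+1) q (cov_cons b (fun=> p)).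
Proof.
move=> ks; have [_ sk] := hT ks.
rewrite (eq_bigr (fun=> contract_first dV (T k.+1) q (cov_cons b (fun=> p)))).
  by rewrite sumr_const mulr_natl cardC1 card_ord.
move=> r rm; rewrite /contract_first -(with_ord0 p b) cov_cons_const cov_cons_with.
rewrite -(with_ord0 p (dV q)) cov_cons_const [in RHS]with_comm; last exact: neq_lift.
by apply: symmetric_with2; [exact: sk|rewrite eq_sym|rewrite eq_sym neq_lift].
Qed.

(** Regrouping by degree in p: the dV term of T_{k+2} joins the R_{T_k} term in degree k+1, and the
    dV term of T_1 is left alone in degree 0. *)
Lemma residual_excess q p xi : residual (Covector q p) xi =
  \sum_(k < s.+1) ((k.+1)`!%:R)^-1 * excess k q (cov_cons (flat g q xi) (fun=> p))
  - potential_form q xi.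
Proof.
set b := flat g q xi.
pose S k := (k`!%:R : R)^-1 * \sum_(r < k.+1 | r != ord_max)
    T k q [eta [eta (fun=> p) with ord_max |-> b] with r |-> dV q].
pose C k := (k`!%:R : R)^-1 * contract_first dV (T k.+1) q (cov_cons b (fun=> p)).
have S0 : S 0%N = 0.
  by rewrite /S big1 ?mulr0 // => r; rewrite (ord1 r).
have SS k : (k.+1 <= s)%N -> S k.+1 = C k.
  move=> ks; rewrite /S /C sum_two_slots // factS natrM invfM mulrACA.
  by rewrite mulVf ?mul1r // pnatr_eq0.
have SC : \sum_(k < s.+1) S k =
    (\sum_(k < s.+1) if (k.+2 <= s)%N then C k.+1 else 0) + potential_form q xi.
  rewrite big_ord_recl S0 add0r (eq_bigr (fun k : 'I_s => C k)); last first.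
    by move=> k _; rewrite SS.
  (* After the shift by one, the [dV] terms of T_1, .., T_s remain. For s = 0 there are none;
     otherwise the first is the potential form, and the last two indices of the conditional sum
     contribute 0. *)
  rewrite /potential_form; case: (s) => [|s'].
    by rewrite big_ord0 big_ord_recl big_ord0 !addr0.
  rewrite big_ord_recl [in RHS]big_ord_recr [in RHS]big_ord_recr /=.
  rewrite !ltnn ltnNge leqnSn /= !addr0 addrC; congr (_ + _).
    by apply: eq_bigr => k _; rewrite ltnS ltn_ord.
  rewrite /C fact0 invr1 mul1r; congr (contract_first _ _ _ _).
  by apply/funext => i; rewrite (ord1 i) cov_cons0.
rewrite /residual.
transitivity (\sum_(k < s.+1) ((k.+1)`!%:R)^-1 *
    RT A g nabla (T k) q (cov_cons b (fun=> p)) - \sum_(k < s.+1) S k).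
  by rewrite -sumrB.
rewrite SC opprD addrA -sumrB; congr (_ - _); apply: eq_bigr => k _.
by rewrite /excess [RHS]mulrBr; congr (_ - _); case: ifP; rewrite ?mulr0.
Qed.

Lemma residual_no_excess : (forall k, (k <= s)%N -> forall q al, excess k q al = 0) ->
  forall m xi, residual m xi = - potential_form (foot m) xi.
Proof.
move=> h [q p] xi; rewrite residual_excess big1 ?sub0r // => k _.
by rewrite h ?mulr0 // -ltnS.
Qed.

(* Along the ray [r p] the residual is a polynomial in [r], in which [excess k]
   is, up to a factor, the coefficient of [r ^ k.+1]. *)
Lemma excess_eq0 : (forall q p xi, residual (Covector q p) xi = residual (Covector q 0) xi) ->
  forall k, (k <= s)%N -> forall q al, excess k q al = 0.
Proof.
move=> h k ks q al; rewrite [al]cov_cons_head_tail.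
move: (al ord0) (fun i => al (lift ord0 i)) => b tl.
apply: (polarization (excess_multilinear q b ks) (excess_symmetric q b ks)) => p.
rewrite -(sharpK hg q b); set xi := sharp g q b.
pose e i := ((i.+1)`!%:R : R)^-1 * excess i q (cov_cons (flat g q xi) (fun=> p)).
suff : e k = 0.
  by move/eqP; rewrite mulf_eq0 invr_eq0 pnatr_eq0 -leqn0 leqNgt fact_gt0 => /eqP.
(* The shift matches [e k] with the power [k.+1]; the constant coefficient is 0. *)
pose e' i := if i is j.+1 then e j else 0.
apply: (@polynomial_identity R s.+2 e' _ k.+1) => // t.
rewrite big_ord_recl mul0r add0r.
have E r : \sum_(i < s.+1) ((i.+1)`!%:R)^-1 *
    excess i q (cov_cons (flat g q xi) (fun=> r *: p)) =
    \sum_(i < s.+1) e i * r ^+ i.+1.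
  apply: eq_bigr => i _; have is_ : (i <= s)%N by rewrite -ltnS.
  rewrite (multilinear_homogeneous r p (excess_multilinear q (flat g q xi) is_)).
  by rewrite mulrA mulrAC.
rewrite -[LHS](E t) -[LHS](subrK (potential_form q xi)) -residual_excess.
rewrite (h q (t *: p)) -(h q (0 *: p)) residual_excess subrK E.
by rewrite big1 // => i _; rewrite expr0n mulr0.
Qed.

End Residual.

Arguments excess {R n Q} A g nabla V s T k q al.
Arguments potential_form {R n Q} A g V s T q xi.

(** * Closedness of the form and the equivalence *)

Section Fouling.
Context {R : realType} {n : nat} {Q : topologicalType} {A : @charted R n Q}.
Context (hQ : smooth_manifold A) {g : Q -> 'M[R]_n} (hg : semi_riemannian A g).
Context {nabla : Q -> 'rV[R]_n -> (Q -> 'rV[R]_n) -> 'rV[R]_n}.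
Context (hnabla : levi_civita A g nabla).
Context {V : Q -> R} (sV : smooth_fun A V).
Context {s : nat} {T : forall k : nat, tensor R n Q k.+1}.
Arguments T : clear implicits.
Context (hT : forall k, (k <= s)%N -> tensor_field A (T k) /\ tensor_symmetric (T k)).
Implicit Types (u v a : 'rV[R]_n) (z w : 'rV[R]_(n + n)) (c : @chart R n Q).
Local Notation nat_chart c := (natural_chart A c).
Local Notation CA := (cotangent_charted A).
Local Notation dV := (d_cov A V).
Local Notation residual := (residual A g nabla V s T).
Local Notation excess := (excess A g nabla V s T).
Local Notation pot := (potential_form A g V s T).

Let tT k : (k <= s)%N -> tensor_field A (T k).
Proof. by move=> /hT []. Qed.

(** In natural coordinates the field is (dH/dp, -dH/dq); [d0] is linear in the vector at every point
    because ['d] is. *)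
Lemma hamiltonian_vf_exists (H : @cotangent R n Q -> R) :
  exists X, is_hamiltonian_vf A H X.
Proof.
exists (fun m => row_mx (covector_of (fun v => d0 CA H m (row_mx 0 v)))
                        (- covector_of (fun v => d0 CA H m (row_mx v 0)))).
move=> m w; rewrite /interior_product omegaE row_mxKl row_mxKr.
rewrite (pairingC (lsubmx w)) pairingNl opprK.
rewrite !pairing_covector_of_fun.
- rewrite /d0 -linearD add_row_mx addr0 add0r; congr ('d _ _ _).
  by rewrite hsubmxK.
- move=> k u v; rewrite /d0 -linearP; congr ('d _ _ _).
  by rewrite scale_row_mx add_row_mx scaler0 addr0.
- move=> k u v; rewrite /d0 -linearP; congr ('d _ _ _).
  by rewrite scale_row_mx add_row_mx scaler0 addr0.
Qed.

Lemma Psi_sum_bundle_map : is_bundle_map A (Psi_sum g s T).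
Proof.
split=> // m; set c := chart_at A (foot m).
have Ac : atlas A c := chart_at_atlas hQ _.
exists (nat_chart c), (nat_chart c); split.
- by exists c.
- by exists c.
- exact: (chart_at_dom hQ).
exists (natural_dom c); split.
- exact: (natural_dom_open hQ).
- by rewrite /natural_dom /= row_mxKl; apply/cimg_cmap/(chart_at_dom hQ).
- move=> z cz; exists (cinv (nat_chart c) z); first exact: (cinv_dom hQ).
  exact: (natural_cinvK hQ).
- by move=> z cz; apply: (cinv_dom hQ).
exact: (Psi_sum_smooth hQ hg tT).
Qed.

Definition potential_chart c x v : R := pot (cinv c x) (of_chart A c (cinv c x) v).

Lemma potential_chart_smooth c v : atlas A c ->
  smooth_on (cimg c) (fun x => potential_chart c x v : R^o).
Proof.
move=> Ac r; have oc := sm_img_open hQ Ac; rewrite /potential_chart /potential_form.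
case: (boolP (1 <= s)%N) => [s1|_]; last exact: Ck_cst.
have t1 := tT s1.
pose al (i : 'I_2) x := cov_cons (dchart V c x) (fun _ : 'I_1 => v *m gram A g c x) i.
apply: (@Ck_ext _ _ _ _ _ (fun x => tensor_in_chart A c (T 1) (fun i => al i x) x)) => //.
  move=> x cx; rewrite /contract_first; congr (T _ _ _).
  apply: cov_cons_eq => [|i]; rewrite /al.
    by rewrite cov_cons0 (d_cov_chart hQ).
  by rewrite cov_consS (flat_of_chart hQ).
apply: (@Ck_multilinear R n 'rV[R]_n 2
  (fun x be => tensor_in_chart A c (T 1) be x) _ (cimg c) r al oc).
- by move=> x; apply: tensor_in_chart_multilinear.
- by move=> be; apply: (tf_smooth t1 Ac).
move=> i l; rewrite /al; have [j ->|->] := unliftP ord0 i.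
  rewrite (_ : (fun _ => _) = fun x => (v *m gram A g c x) 0 l).
    exact: (Ck_mul_gram hQ hg).
  by apply/funext => x; rewrite cov_consS.
rewrite (_ : (fun _ => _) = fun x => dchart V c x 0 l).
  exact: (dchart_smooth hQ).
by apply/funext => x; rewrite cov_cons0.
Qed.

(** Symmetry of g moves [flat] onto the argument: flat(i_{dV} T_1)(w) = T_1(dV, flat w), which is
    the potential form. *)
Lemma d1_potential q u v : (1 <= s)%N ->
  d1 A (fun q' (w : 'rV[R]_n) => pairing
     (flat g q' (vf_of_tensor (contract_first dV (T 1%N)) q')) w) q u v =
  'D_u (fun x => potential_chart (chart_at A q) x v : R^o) (cmap (chart_at A q) q) -
  'D_v (fun x => potential_chart (chart_at A q) x u : R^o) (cmap (chart_at A q) q).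
Proof.
move=> s1; have t1 := tf_multilinear (tT s1).
suff E (w : 'rV[R]_n) : form_in_chart A (chart_at A q) (fun q' (w : 'rV[R]_n) => pairing
     (flat g q' (vf_of_tensor (contract_first dV (T 1%N)) q')) w) ^~ w =
   fun x => potential_chart (chart_at A q) x w by rewrite /d1 !E.
apply/funext => x; rewrite /form_in_chart /potential_chart.
set q' := cinv _ x; set v' := of_chart _ _ _ _.
rewrite -[LHS]/(gform (g q') _ _) (gform_sym hg) gform_pairing -[v' *m g q']/(flat g q' v').
rewrite /potential_form s1; set b := flat g q' v'.
have t2 := multilinear_cons (dV q') (t1 q').
have -> : (fun=> b) = [eta (fun _ : 'I_1 => b) with ord0 |-> b].
  by apply/funext => i; rewrite (ord1 i).
rewrite /contract_first (multilinear_coord t2) pairingE; apply: eq_bigr => l _.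
rewrite [X in _ * X = _]mxE; congr (_ * T _ _ (cov_cons _ _)); apply/funext => i.
by rewrite (ord1 i).
Qed.

Section Closedness.
Context (X : @cotangent R n Q -> 'rV[R]_(n + n)).
Context (hX : is_hamiltonian_vf A (mechanical g V) X).
Local Notation beta :=
  (interior_product X (pullback CA CA (Psi_sum g s T) (omega (n := n)))).

(** Horizontality of rho: it vanishes on vectors with zero base part. The value is read off from
    theta = dF - rho at the zero vector, where theta and dF vanish. *)
Lemma residual0 q p : residual (Covector q p) 0 = 0.
Proof.
have := interior_product_centre hQ hg hnabla sV hT q p 0 hX.
have -> : lsubmx (0 : 'rV[R]_(n + n)) = (0 : 'rV[R]_n) by rewrite linear0.
have -> : d0 CA (fibre_defect s T) (Covector q p) 0 = 0 by rewrite /d0 linear0.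
have -> : beta (Covector q p) 0 = 0.
  rewrite /interior_product /pullback omegaE.
  have -> : tangent_map CA CA (Psi_sum g s T) (Covector q p) 0 = 0.
    by rewrite /tangent_map linear0.
  by rewrite !linear0 (pairingC _ 0) !pairing0l subrr.
by rewrite sub0r => /esym/eqP; rewrite oppr_eq0 => /eqP.
Qed.

Section AtPoint.
Context (q : Q) (p : 'rV[R]_n).
Local Notation c := (chart_at A q).
Local Notation x0 := (cmap (chart_at A q) q).
Local Notation z0 := (row_mx (cmap (chart_at A q) q) p).

Let Ac : atlas A c := chart_at_atlas hQ q.

Definition residual_chart z w : R :=
  residual (cinv (nat_chart c) z) (of_chart A c (cinv c (lsubmx z)) (lsubmx w)).

(* The exact part of the form drops out by the symmetry of second derivatives. *)
Lemma d1_residual_chart (u' v' : 'rV[R]_(n + n)) (du dv : R) :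
  is_derive z0 u' (residual_chart ^~ v' : _ -> R^o) dv ->
  is_derive z0 v' (residual_chart ^~ u' : _ -> R^o) du ->
  d1 CA beta (Covector q p) u' v' = du - dv.
Proof.
move=> hv hu; pose phi : 'rV[R]_(n + n) -> R^o := fibre_defect s T \o cinv (nat_chart c).
have Cphi : Ck 2 (natural_dom c) phi by apply: (fibre_defect_smooth hQ tT Ac).
have zc := natural_dom_centre hQ q p.
have D w w' d : is_derive z0 w (residual_chart ^~ w' : _ -> R^o) d ->
    'D_w (form_in_chart CA (nat_chart c) beta ^~ w' : _ -> R^o) z0 =
    'D_w ('D_w' phi) z0 - d.
  move=> hd; have [dphi Dphi] := Cphi.
  have dd : is_derive z0 w ('D_w' phi) ('D_w ('D_w' phi) z0).
    by apply: derivableP; apply: diff_derivable; have [+ _] := Dphi w'; apply.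
  have [_ <-] := is_deriveB dd hd; apply: near_eq_derive.
  apply: filterS (near_natural_dom hQ q p) => z cz.
  rewrite (form_in_natural_chart hQ hg hnabla sV hT _ hX Ac cz).
  by rewrite -deriveE //; apply: dphi.
rewrite /d1 -[X in derive _ X](_ : cmap (nat_chart c) (Covector q p) = _) //.
rewrite -[X in _ - derive _ X _](_ : cmap (nat_chart c) (Covector q p) = _) //.
rewrite (natural_chart_centre hQ) (D _ _ _ hv) (D _ _ _ hu).
have cancel_exact (e e' : R) : e = e' -> e - dv - (e' - du) = du - dv.
  by move=> ->; ring.
exact: (cancel_exact _ _ (Ck2_sym v' u' (natural_dom_open hQ Ac) zc Cphi)).
Qed.

Lemma d1_no_excess (u' v' : 'rV[R]_(n + n)) : (forall k, (k <= s)%N -> forall q al, excess k q al = 0) ->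
  d1 CA beta (Covector q p) u' v' =
  'D_(lsubmx u') (fun x => potential_chart c x (lsubmx v') : R^o) x0 -
  'D_(lsubmx v') (fun x => potential_chart c x (lsubmx u') : R^o) x0.
Proof.
move=> h.
have D w w' : is_derive z0 w (residual_chart ^~ w' : _ -> R^o)
    (- 'D_(lsubmx w) (fun x => potential_chart c x (lsubmx w') : R^o) x0).
  rewrite (_ : residual_chart ^~ w' = fun z => - potential_chart c (lsubmx z) (lsubmx w')).
    apply: is_deriveN.
    apply: (@is_derive_comp_lsubmx R n R^o (fun x => potential_chart c x (lsubmx w'))).
    rewrite row_mxKl; apply: derivableP; apply: diff_derivable.
    have [+ _] := potential_chart_smooth (lsubmx w') Ac 1; apply.
    exact/cimg_cmap/(chart_at_dom hQ).
  by apply/funext => z; rewrite /residual_chart (residual_no_excess _ h).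
by rewrite (d1_residual_chart (D u' v') (D v' u')) opprK addrC.
Qed.

End AtPoint.

(** Only existence is recorded; [closed_residual] identifies the value with a component of d
    theta. *)
Lemma is_derive_residual_ray q p xi (t : R^o) :
  exists d, is_derive t (1 : R^o) (fun r : R^o => residual (Covector q (r *: p)) xi : R^o) d.
Proof.
set b := flat g q xi.
have dray (r : R^o) : is_derive r (1 : R^o) (fun r : R^o => r *: p) p.
  rewrite (_ : (fun r : R^o => r *: p) = fun r : R^o => 0 + r *: p).
    exact: is_derive_affine.
  by apply/funext => r'; rewrite add0r.
have dk (k : 'I_s.+1) := is_derive_multilinear
  (fun _ : R^o => excess_multilinear hQ hnabla hT q b (ltnSE (ltn_ord k)))
  (fun be => is_derive_cst (excess k q (cov_cons b be) : R^o) t (1 : R^o))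
  (fun _ : 'I_k.+1 => dray t).
have d := is_deriveB (is_derive_bigsum (index_enum 'I_s.+1)
    (fun k : 'I_s.+1 => is_derive_mull (((k.+1)`!%:R)^-1) (dk k)))
  (is_derive_cst (pot q xi : R^o) t (1 : R^o)).
eexists; apply: near_eq_is_derive d.
by apply: filterE => r; rewrite (residual_excess hT).
Qed.

(** It suffices that rho be constant along each ray r p from r = 0 to r = 1, and its derivative
    along the ray is, up to sign, d theta on a vertical and a horizontal vector. *)
Lemma closed_residual : (forall m (u v : 'rV[R]_(n + n)), d1 CA beta m u v = 0) ->
  forall q p xi, residual (Covector q p) xi = residual (Covector q 0) xi.
Proof.
move=> h q p xi; pose f := fun r : R^o => residual (Covector q (r *: p)) xi : R^o.
suff f0 (r : R) : is_derive r (1 : R) f 0.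
  by have := is_derive_0_is_cst 1 0 f0; rewrite /f scale1r scale0r.
have [d fd] := is_derive_residual_ray q p xi r.
pose c := chart_at A q; pose z0 := row_mx (cmap c q) (r *: p).
pose u := row_mx (0 : 'rV[R]_n) p; pose w := row_mx xi (0 : 'rV[R]_n).
(* Moving along [u] keeps the foot at [q], the centre of its preferred chart. There all conversions
   are the identity, so the difference quotients in the natural chart are those of [f]. *)
have du : is_derive z0 u (residual_chart q ^~ w : _ -> R^o) d.
  have E : (fun h : R => h^-1 *: (((residual_chart q ^~ w : _ -> R^o) \o shift z0) (h *: u)
        - residual_chart q z0 w)) =
     (fun h : R => h^-1 *: ((f \o shift r) (h *: 1) - f r)).
    have E1 t : residual_chart q (row_mx (cmap c q) (t *: p)) w = f t.
      rewrite /residual_chart /= row_mxKl row_mxKr.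
      rewrite (sm_cancel hQ (chart_at_atlas hQ q) (chart_at_dom hQ q)).
      by rewrite (cov_of_chart_centre hQ) (of_chart_centre hQ) row_mxKl.
    apply/funext => t /=; rewrite E1 /u /z0 scale_row_mx add_row_mx scaler0 add0r.
    by rewrite -scalerDl E1 -[t *: 1]/(t * 1) mulr1.
  case: fd => cf <-; apply: DeriveDef; last by rewrite /derive E.
  by rewrite /derivable E.
have dw : is_derive z0 w (residual_chart q ^~ u : _ -> R^o) 0.
  rewrite (_ : residual_chart q ^~ u = cst 0); first exact: is_derive_cst.
  apply/funext => z; rewrite /residual_chart row_mxKl /of_chart linear0.
  exact: residual0.
have := d1_residual_chart du dw; rewrite h sub0r => /esym/eqP.
by rewrite oppr_eq0 => /eqP d0; rewrite -d0.
Qed.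

End Closedness.
End Fouling.

Arguments potential_chart {R n Q} A g V s T c x v.

Theorem theorem4p10 (R : realType) (n : nat) (Q : topologicalType)
    (A : @charted R n Q) (hQ : smooth_manifold A)
    (g : Q -> 'M[R]_n) (hg : semi_riemannian A g)
    (nabla : Q -> 'rV[R]_n -> (Q -> 'rV[R]_n) -> 'rV[R]_n)
    (hnabla : levi_civita A g nabla)
    (s : nat) (T : forall k : nat, tensor R n Q k.+1)
    (hT : forall k : nat, (k <= s)%N ->
       tensor_field A (T k) /\ tensor_symmetric (T k))
    (V : Q -> R) (hV : smooth_fun A V) :
  fouling_map A (mechanical g V) (Psi_sum g s T) <->
  [/\ (forall k : nat, (k.+2 <= s)%N ->
         forall q al,
           RT A g nabla (T k) q al = contract_first (d_cov A V) (T k.+2) q al),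
      (forall k : nat, k = s \/ k.+1 = s ->
         forall q al, RT A g nabla (T k) q al = 0) &
      ((1 <= s)%N -> forall q u v,
         d1 A (fun q' w => pairing
                 (flat g q' (vf_of_tensor (contract_first (d_cov A V) (T 1%N)) q'))
                 w) q u v = 0)].
Proof.
split.
- move=> [_ [X [hX closed]]].
  have no_excess := excess_eq0 hQ hg hnabla hT
    (closed_residual hQ hg hnabla hV hT hX closed).
  split.
  + move=> k ks q al; have := no_excess k (ltnW (ltnW ks)) q al.
    by rewrite /excess ks => /eqP; rewrite subr_eq0 => /eqP.
  + move=> k hk q al.
    have [ks nks] : (k <= s)%N /\ ~~ (k.+2 <= s)%N.
      by case: hk => <-; rewrite ?leqnn ?leqnSn -?ltnNge // ltnW.
    by have := no_excess k ks q al; rewrite /excess (negPf nks) subr0.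
  + move=> s1 q u v; rewrite (d1_potential hg hT _ _ _ s1).
    (* With no excess, d theta is the pullback of a 2-form on the base, so (iii) is obtained from
       lifted vectors at zero momentum. *)
    have := d1_no_excess hQ hg hnabla hV hT hX q 0 (row_mx u 0) (row_mx v 0) no_excess.
    by rewrite closed !row_mxKl => <-.
move=> [c1 c2 c3]; split; first exact: (Psi_sum_bundle_map hQ hg hT).
have [X hX] := hamiltonian_vf_exists (A := A) (mechanical g V).
have no_excess k : (k <= s)%N -> forall q al, excess A g nabla V s T k q al = 0.
  move=> ks q al; rewrite /excess; case: ifP => [k2|nk2]; first by rewrite c1 // subrr.
  (* Among [k <= s], the failure of [k.+2 <= s] leaves exactly the two cases of (ii). *)
  rewrite subr0; apply: c2; move: ks; rewrite leq_eqVlt => /orP[/eqP|]; first by left.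
  by rewrite leq_eqVlt nk2 orbF => /eqP; right.
exists X; split=> // -[q p] u v.
rewrite (d1_no_excess hQ hg hnabla hV hT hX _ _ _ _ no_excess).
have [s1|s0] := boolP (1 <= s)%N.
  by rewrite -(d1_potential hg hT _ _ _ s1) c3.
(* For s = 0 condition (iii) is vacuous, and the potential form is zero by its definition. *)
have pot0 w : (fun x => potential_chart A g V s T
    (chart_at A q) x w : R^o) = cst 0.
  by apply/funext => x; rewrite /potential_chart /potential_form (negPf s0).
by rewrite !pot0 !derive_cst subrr.
Qed.
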